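(* Let $\boldsymbol{a}$ be a weak composition of $r$ of length $k$, $\boldsymbol{b}$ a weak composition of $s$ of length $m$, $n\geq 2r+2s$, and let $\lambda\in\Lambda^{P_{r+s}(n)}$, i.e. $\lambda\vdash n$ with $n-\lambda_1\le r+s$. The set $\{y_{\hat T}:\hat T\in\mathcal{SSMT}(\lambda,\boldsymbol{a},\boldsymbol{b})\}$ forms a basis for $\mathrm{MP}_{\boldsymbol{a},\boldsymbol{b}}^\lambda$ (the vectors $y_{\hat T}$ being indexed by $\mathcal{SSMT}(\lambda,\boldsymbol{a},\boldsymbol{b})$).
   Context: **Alphabets.** A weak composition of $r$ of length $k$ is a sequence of $k$ non-negative integers with sum $r$. We use plain symbols $1,2,\dots$ and barred symbols $\overline1,\overline2,\dots$, each ordered as the integers, with $i<\overline j$ for all $i,j$. $[k]^{\boldsymbol a}$ is the multiset in which $i$ has multiplicity $\boldsymbol a_i$, and $[\overline m]^{\boldsymbol b}$ the multiset in which $\overline j$ has multiplicity $\boldsymbol b_j$. A multiset partition of a multiset is a multiset of nonempty multisets (blocks) whose multiset union is the given one; throughout, no barred symbol is repeated inside a block. Last-letter order on multisets over a totally ordered alphabet: $\tilde S<\tilde R$ if $\tilde S$ is empty and $\tilde R$ is not, or $\max\tilde S<\max\tilde R$, or $\max\tilde S=\max\tilde R=u$ and $\tilde S\smallsetminus\{u\}<\tilde R\smallsetminus\{u\}$ (removing one copy of $u$). **Tableaux.** Young diagrams are in French convention (row 1 at the bottom, of length $\lambda_1$). A multiset partition tableau of shape $\lambda$ is a filling of the Young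 diagram of $\lambda$ by multisets such that every box above the first row is nonempty, while in the first row some boxes are empty, including the first $\lambda_2$ ones. Its content is the multiset of contents of its nonempty boxes. $\mathcal{MT}(\lambda,\boldsymbol a,\boldsymbol b)$ is the set of those whose content is a multiset partition of $[k]^{\boldsymbol a}\uplus[\overline m]^{\boldsymbol b}$. $\mathcal{SSMT}(\lambda,\boldsymbol a,\boldsymbol b)\subseteq\mathcal{MT}(\lambda,\boldsymbol a,\boldsymbol b)$ is the subset of semistandard tableaux: rows (left to right) and columns (bottom to top) weakly increase in last-letter order; two identical blocks with an even number of barred entries are never in the same column; two identical blocks with an odd number of barred entries are never in the same row. $\mathcal{SMT}(\lambda,q)$ is the set of multiset partition tableaux of shape $\lambda$ whose content is a set partition of $[q]$ and whose rows and columns increase in last-letter order (empty boxes leftmost in the first row). **The modules $P_q^\lambda$.** For $n\ge 2q$, the simple modules of the partition algebra $P_q(n)$ are $P_q^\lambda$, $\lambda\in\Lambda^{P_q(n)}=\{\lambda\vdash n: n-\lambda_1\le q\}$. $P_q^\lambda$ is the $\mathbb{C}$-vector space with basis $\{v_T:T\in\mathcal{SMT}(\lambda,q)\}$. For an arbitrary multiset partition tableau $T$ of shape $\lambda$ with content a set partition of $[q]$, the vector $v_T\in P_q^\lambda$ is defined by: permuting the boxes of the first row does not change $v_T$; and with respect to the rows above the first row, $v_T$ obeys the straightening rules of Specht modules, i.e. interchanging two boxes in the same column above the first row changes the sign of $v_T$, and the usual Garnir relations hold. (Equivalently, $P_q^\lambda$ is the direct sum, over all pairs $(F,U)$ of disjoint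 sets of blocks with $F\cup U$ a set partition of $[q]$ and $|U|=n-\lambda_1$, of a copy of the Specht module of shape $(\lambda_2,\lambda_3,\dots)$ for the symmetric group on the set $U$; $v_T$ is the polytabloid of the part of $T$ above the first row, in the summand where $F$ is the set of first-row blocks and $U$ the set of other blocks of $T$.) The subgroup $S_q\subset P_q(n)$ (with $\sigma$ corresponding to the diagram $\{\{\sigma(1),\underline1\},\dots,\{\sigma(q),\underline q\}\}$) acts by $\sigma v_T=v_{\sigma T}$, where $\sigma T$ replaces each entry $i$ of $T$ by $\sigma(i)$. Only this part of the $P_q(n)$-action is needed here. **The modules $\mathrm{MP}^\lambda_{\boldsymbol a,\boldsymbol b}$.** $\kappa_{\boldsymbol a,\boldsymbol b}:[r+s]\to[k]\cup[\overline m]$ is the weakly increasing map taking each value $i\in[k]$ exactly $\boldsymbol a_i$ times and each $\overline j$ exactly $\boldsymbol b_j$ times; it is applied to tableaux entrywise. $S_{\boldsymbol a}\times S_{\boldsymbol b}\subseteq S_{r+s}$ is the subgroup preserving every fibre of $\kappa_{\boldsymbol a,\boldsymbol b}$, with elements written $\sigma\tau$, $\sigma\in S_{\boldsymbol a}$ permuting $\{1,\dots,r\}$, $\tau\in S_{\boldsymbol b}$ permuting $\{r+1,\dots,r+s\}$. Let $$e_{\boldsymbol a,\boldsymbol b}=\frac{1}{|S_{\boldsymbol a}\times S_{\boldsymbol b}|}\sum_{\sigma\tau\in S_{\boldsymbol a}\times S_{\boldsymbol b}}\operatorname{sgn}(\tau)\,\sigma\tau\in\mathbb{C}S_{r+s}\subseteq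 P_{r+s}(n),\qquad \mathrm{MP}_{\boldsymbol a,\boldsymbol b}^\lambda=e_{\boldsymbol a,\boldsymbol b}P_{r+s}^\lambda .$$ This is a module over $\mathrm{MP}_{\boldsymbol a,\boldsymbol b}(n)=e_{\boldsymbol a,\boldsymbol b}P_{r+s}(n)e_{\boldsymbol a,\boldsymbol b}$. **The vectors $y_{\tilde T}$.** For $\tilde T\in\mathcal{MT}(\lambda,\boldsymbol a,\boldsymbol b)$, its standardization $T$ is the following tableau with $\kappa_{\boldsymbol a,\boldsymbol b}(T)=\tilde T$. List the blocks of the content of $\tilde T$ in weakly increasing last-letter order and, for each symbol, replace its occurrences from left to right by the elements of its preimage under $\kappa_{\boldsymbol a,\boldsymbol b}$ in increasing order; this gives the blocks of $T$. Blocks of $T$ with the same image under $\kappa_{\boldsymbol a,\boldsymbol b}$ are placed, in increasing last-letter order, in the boxes of $\tilde T$ with that content, taken row by row from the bottom row up and left to right in each row. Define $y_{\tilde T}=e_{\boldsymbol a,\boldsymbol b}v_T$. (Any other $T$ with $\kappa_{\boldsymbol a,\boldsymbol b}(T)=\tilde T$ would change $y_{\tilde T}$ only by a sign.) *)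

(* Defs.v *)
From HB Require Import structures.
From mathcomp Require Import all_boot all_order all_fingroup all_algebra.
From mathcomp Require Export reals complex.

Set Implicit Arguments.
Unset Strict Implicit.
Unset Printing Implicit Defensive.

Import GRing.Theory.

Definition is_partition (la : seq nat) (n : nat) : bool :=
  [&& sorted geq la, 0 \notin la & sumn la == n].

(* Rows and columns are counted from 0, row 0 being the bottom row.           *)
Definition box (la : seq nat) : finType :=
  {i : 'I_(size la) & 'I_(nth 0 la i)}.

Definition box_row (la : seq nat) (c : box la) : nat := tag c.
Definition box_col (la : seq nat) (c : box la) : nat := tagged c.

Definition read_before (la : seq nat) (c c' : box la) : bool :=
  (box_row c < box_row c') ||
  (box_row c == box_row c') && (box_col c < box_col c').

Definition tableau_shape (B : eqType) (empty : B) (la : seq nat)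
    (T : {ffun box la -> B}) : bool :=
  [forall c, (0 < box_row c) ==> (T c != empty)] &&
  [forall c,
     (box_row c == 0) && (box_col c < nth 0 la 1) ==> (T c == empty)].

(* Last-letter order. A finite multiset of naturals is given by its weakly    *)
(* decreasing word, so that its maximum is the head of the word and removing  *)
(* one copy of the maximum leaves the tail.                                   *)
Fixpoint ll_lt (s t : seq nat) : bool :=
  match s, t with
  | _, [::] => false
  | [::], _ :: _ => true
  | u :: s', v :: t' => (u < v) || (u == v) && ll_lt s' t'
  end.

Definition ll_le (s t : seq nat) : bool := (s == t) || ll_lt s t.

Section SetTableaux.
Variables (q : nat) (la : seq nat).

Definition set_word (B : {set 'I_q}) : seq nat :=
  map val (rev (enum B)).

Definition set_tableau : finType := {ffun box la -> {set 'I_q}}.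

Definition is_set_tableau (T : set_tableau) : bool :=
  tableau_shape set0 T && [forall i, \sum_c (i \in T c) == 1].

Definition perm_tableau (g : {perm 'I_q}) (T : set_tableau) : set_tableau :=
  [ffun c => g @: T c].

(* A tabloid records the set of blocks in each row. Keeping the first row in  *)
(* it separates the summands indexed by the pairs (F, U).                     *)
Definition tabloid : finType := {ffun 'I_(size la) -> {set {set 'I_q}}}.

Definition tabloid_of (T : set_tableau) : tabloid :=
  [ffun i => [set T c | c in [pred c | (tag c == i) && (T c != set0)]]].

Definition perm_tabloid (g : {perm 'I_q}) (t : tabloid) : tabloid :=
  [ffun i => [set g @: (B : {set 'I_q}) | B in t i]].

(* The column group of the part of the diagram above the first row.           *)
Definition col_group : {set {perm box la}} :=
  [set p : {perm box la} | [forall c,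
     (box_col (p c) == box_col c) && ((box_row c == 0) ==> (p c == c))]].

Local Open Scope ring_scope.
Variable K : fieldType.

Definition tabloid_space : vectType K := {ffun tabloid -> K^o}.

Definition tabloid_vec (t : tabloid) : tabloid_space :=
  [ffun t' => (t' == t)%:R].

(* The polytabloid of the part of T above the first row.                      *)
Definition v_ (T : set_tableau) : tabloid_space :=
  \sum_(p in col_group)
    (-1) ^+ p *: tabloid_vec (tabloid_of [ffun c => T (p c)]).

Definition Pmod : {vspace tabloid_space} :=
  <<[seq v_ T | T in is_set_tableau]>>%VS.

Definition perm_act (g : {perm 'I_q}) : 'End(tabloid_space) :=
  linfun (fun f : tabloid_space =>
    \sum_t f t *: tabloid_vec (perm_tabloid g t)).

Lemma perm_act_tabloid_vec g t :
  perm_act g (tabloid_vec t) = tabloid_vec (perm_tabloid g t).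
Proof.
pose f : tabloid_space -> tabloid_space :=
  fun f => \sum_t f t *: tabloid_vec (perm_tabloid g t).
have lf : linear f.
  move=> c u w; rewrite /f scaler_sumr -big_split /=; apply: eq_bigr => x _.
  by rewrite !ffunE scalerDl scalerA.
pose F := GRing.isLinear.Build _ _ _ _ f lf.
pose L : {linear tabloid_space -> tabloid_space} := HB.pack f F.
rewrite /perm_act -/f -[f]/(L : _ -> _) lfunE /= /f.
rewrite (bigD1 t) //= ffunE eqxx scale1r big1 ?addr0 // => x xt.
by rewrite ffunE (negPf xt) scale0r.
Qed.

Lemma perm_act_v g T : perm_act g (v_ T) = v_ (perm_tableau g T).
Proof.
rewrite /v_ linear_sum; apply: eq_bigr => p _.
rewrite linearZ /= perm_act_tabloid_vec; congr (_ *: tabloid_vec _).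
apply/ffunP => i; rewrite !ffunE; apply/setP => B; apply/imsetP/imsetP.
  case=> C /imsetP[c]; rewrite !inE !ffunE => /andP[ci nz] -> ->.
  exists c; rewrite ?ffunE // !inE ci !ffunE /=.
  by rewrite -card_gt0 card_imset ?card_gt0 //; apply: perm_inj.
case=> c; rewrite !inE !ffunE => /andP[ci nz] ->.
exists (T (p c)) => //; apply/imsetP; exists c; rewrite ?ffunE // !inE ci.
by rewrite !ffunE /=; apply: contraNneq nz => ->; rewrite imset0.
Qed.

End SetTableaux.

Section MultisetTableaux.
Variables (k m r s : nat) (a : k.-tuple nat) (b : m.-tuple nat) (la : seq nat).

(* The letter x : 'I_(k + m) stands for the plain symbol x + 1 if x < k, and  *)
(* for the barred symbol x - k + 1 otherwise; the order on symbols is that of *)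
(* nat. The bound on multiplicities is harmless, as a block of a multiset     *)
(* partition of a multiset of cardinality r + s has at most r + s elements.   *)
Definition mblock : finType := {ffun 'I_(k + m) -> 'I_(r + s).+1}.

Definition empty_mblock : mblock := [ffun => ord0].

Definition barred (x : 'I_(k + m)) : bool := k <= x.

Definition num_barred (S : mblock) : nat := \sum_(x | barred x) S x.

Definition mword (S : mblock) : seq nat :=
  flatten [seq nseq (S x) (x : nat) | x <- rev (enum 'I_(k + m))].

Definition mle (S R : mblock) : bool := ll_le (mword S) (mword R).

Definition mtableau : finType := {ffun box la -> mblock}.

Definition MT : {set mtableau} :=
  [set T | [&& tableau_shape empty_mblock T,
    [forall x : 'I_(k + m), \sum_c (T c x : nat) == nth 0 (a ++ b) x] &
    [forall c, forall x, barred x ==> (T c x <= 1)]]].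

Definition semistandard (T : mtableau) : bool :=
  [&& [forall c, forall c',
         (box_row c == box_row c') && (box_col c <= box_col c') ==>
         mle (T c) (T c')],
      [forall c, forall c',
         (box_col c == box_col c') && (box_row c <= box_row c') ==>
         mle (T c) (T c')] &
      [forall c, forall c', (c != c') && (T c == T c') ==>
         if odd (num_barred (T c)) then box_row c != box_row c'
         else box_col c != box_col c']].

Definition SSMT : {set mtableau} := [set T in MT | semistandard T].

Definition kappa (i : 'I_(r + s)) : nat :=
  nth 0 (flatten [seq nseq (nth 0 (a ++ b) x) x | x <- iota 0 (k + m)]) i.

(* The preimage of x under kappa, in increasing order.                        *)
Definition fibre (x : nat) : seq 'I_(r + s) :=
  [seq i <- enum 'I_(r + s) | kappa i == x].

Definition kappa_block (B : {set 'I_(r + s)}) : mblock :=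
  [ffun x : 'I_(k + m) => inord #|[set i in B | kappa i == x]|].

Definition sorted_content (T : mtableau) : seq mblock :=
  sort mle [seq T c | c in [pred c | T c != empty_mblock]].

(* The j-th block of the list receives, for each symbol x, the next elements  *)
(* of the preimage of x not used by the previous blocks.                      *)
Definition std_blocks (T : mtableau) : seq {set 'I_(r + s)} :=
  let L := sorted_content T in
  mkseq (fun j => \bigcup_(x : 'I_(k + m))
    [set i in take (nth empty_mblock L j x)
                (drop (\sum_(S <- take j L) S x) (fibre x))]) (size L).

Definition standardization (T : mtableau) : set_tableau (r + s) la :=
  [ffun c =>
    nth set0
      (sort (fun B C => ll_le (set_word B) (set_word C))
            [seq B <- std_blocks T | kappa_block B == T c])
      #|[set c' | (T c' == T c) && read_before c' c]|].

Definition kappa_stable (g : {perm 'I_(r + s)}) : bool :=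
  [forall i, kappa (g i) == kappa i].

Definition plain_young : {set {perm 'I_(r + s)}} :=
  [set g | perm_on [set i : 'I_(r + s) | i < r] g && kappa_stable g].

Definition barred_young : {set {perm 'I_(r + s)}} :=
  [set g | perm_on [set i : 'I_(r + s) | r <= i] g && kappa_stable g].

Local Open Scope ring_scope.
Variable K : fieldType.

Definition e_ab : 'End(tabloid_space (r + s) la K) :=
  (#|plain_young| * #|barred_young|)%:R^-1 *:
    \sum_(g in plain_young) \sum_(h in barred_young)
      (-1) ^+ h *: perm_act la K (g * h)%g.

Definition MPmod : {vspace tabloid_space (r + s) la K} :=
  (e_ab @: Pmod (r + s) la K)%VS.

Definition y_ (T : mtableau) : tabloid_space (r + s) la K :=
  e_ab (v_ K (standardization T)).

End MultisetTableaux.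

(* Main.v *)
Require Import Defs.
From mathcomp Require Import all_boot all_order all_fingroup all_algebra.
From mathcomp Require Import zify.

(** The module [MPmod] is spanned by the images [e v_T] of the polytabloids of
    all set-partition tableaux [T], and up to sign [e v_T] depends only on the
    multiset tableau obtained by applying [kappa] to the entries of [T]: two
    tableaux with the same image differ by an element of the Young subgroup
    ([relabel_tableau]), on which [e] is equivariant up to sign ([e_stable]).
    The guiding sign computation is that exchanging two boxes whose blocks have
    the same image is undone by an element of the Young subgroup whose sign is
    the parity of the number of barred letters of the block ([swap_tableau]):
    blocks with an odd number of barred letters anticommute, the others commute.

    Spanning ([straighten]) is a straightening algorithm in this super setting.
    A block with a repeated barred letter, two equal even blocks in one column,
    or two equal odd blocks in the first row make [e v_T] vanish.
    Columns above the first row can be sorted at the cost of a sign, the first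
    row for free. A violation in a higher row is removed by the Garnir
    relation ([garnir]) on the part of one column above the violation and the
    part of the other column below it. The terms of that relation whose columns
    have the same content as in [T] are all equal to [e v_T] with a positive
    sign, even when the violation is an equality of odd blocks
    ([exchange_sign]); they add up to a positive multiple of [e v_T], which can
    be divided out in characteristic zero. The other terms have moved larger
    blocks to the right. A measure strictly increases at each step, so a
    counterexample of maximal measure cannot exist.

    Linear independence is triangularity. The vector [e v_T] is evaluated at the
    tabloid of a standardization. If [y_S] is nonzero at the tabloid of the
    standardization of [T], then a column permutation of [S] has the same rows as
    [T], so by the rearrangement inequality the sum of (row index) * (rank of the
    block) is at most as large for [T] as for [S], with equality only if
    [S = T] ([y_triangular]). The diagonal coefficient is nonzero because all
    its contributions have the same sign ([y_diagonal]). *)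

Set Implicit Arguments.
Unset Strict Implicit.
Unset Printing Implicit Defensive.

Import GRing.Theory.

(** * Weighted sums under rearrangement *)

Section Combinatorics.

(** Match the elements of corresponding fibres in the order of enumeration. *)
Lemma perm_of_card_fibres (I : finType) (E : eqType) (f g : I -> E) :
    (forall v, #|[set i | f i == v]| = #|[set i | g i == v]|) ->
  exists w : {perm I}, forall i, f (w i) = g i.
Proof.
move=> fgE; pose A v := enum [set i | f i == v].
pose B v := enum [set i | g i == v].
(* The default value i is never returned, by ltA below. *)
pose w0 i := nth i (A (g i)) (index i (B (g i))).
have ltA i : index i (B (g i)) < size (A (g i)).
  by rewrite -cardE fgE cardE index_mem mem_enum inE.
have fw0 i : f (w0 i) = g i.
  by have /(mem_nth i) := ltA i; rewrite mem_enum inE => /eqP.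
have w0_inj : injective w0.
  move=> i j wij; have gij : g i = g j by rewrite -!fw0 wij.
  move: wij (ltA i) (ltA j); rewrite /w0 gij => wij ltAi ltAj.
  move/eqP: wij; rewrite (set_nth_default j) // nth_uniq ?enum_uniq //.
  move/eqP/(congr1 (nth i (B (g j)))).
  by rewrite !nth_index // mem_enum inE ?gij.
by exists (perm w0_inj) => i; rewrite permE.
Qed.

(** On each line the superlevel sets of a monotone function are closed upwards,
    hence nested; those of [f] and [f \o w] at the same level have the same size,
    so they coincide. This is uniqueness of the sorted rearrangement, used both
    for rows and for columns. *)
Lemma monotone_rearrangement (I : finType) (line pos f : I -> nat)
    (w : {perm I}) :
    (forall c, line (w c) = line c) ->
    (forall c d, line c = line d -> pos c <= pos d -> f c <= f d) ->
    (forall c d, line c = line d -> pos c <= pos d -> f (w c) <= f (w d)) ->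
  forall c, f (w c) = f c.
Proof.
move=> wl fM fwM c; apply/eqP; apply: contraT => neq.
pose U t := [set d | (line d == line c) && (t <= f d)].
pose U' t := [set d | (line d == line c) && (t <= f (w d))].
have cardU t : #|U' t| = #|U t|.
  rewrite -(card_imset (U' t) (@perm_inj _ w)); apply: eq_card => d.
  apply/imsetP/idP => [[e] | dU].
    by rewrite !inE => /andP[/eqP le te] ->; rewrite wl le eqxx.
  exists (w^-1%g d); last by rewrite permKV.
  by move: dU; rewrite !inE permKV -(wl (w^-1%g d)) permKV.
case: (ltngtP (f (w c)) (f c)) neq => // fc _.
- have sub : U' (f c) \proper U (f c).
    apply/properP; split; last first.
      by exists c; rewrite !inE eqxx ?leqnn // -ltnNge.
    apply/subsetP=> d; rewrite !inE => /andP[/eqP ld fd]; rewrite ld eqxx /=.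
    apply: fM => //; rewrite leqNgt; apply/negP => /ltnW /(fwM _ _ ld) fwd.
    by move: (leq_trans fd fwd); rewrite leqNgt fc.
  by move/proper_card: sub; rewrite cardU ltnn.
have sub : U (f (w c)) \proper U' (f (w c)).
  apply/properP; split; last first.
    by exists c; rewrite !inE eqxx ?leqnn // -ltnNge.
  apply/subsetP=> d; rewrite !inE => /andP[/eqP ld fd]; rewrite ld eqxx /=.
  apply: fwM => //; rewrite leqNgt; apply/negP => /ltnW /(fM _ _ ld) fwd.
  by move: (leq_trans fd fwd); rewrite leqNgt fc.
by move/proper_card: sub; rewrite cardU ltnn.
Qed.

Lemma weight_perm (I : finType) (wt f : I -> nat) (w : {perm I}) :
  (forall c, wt (w c) = wt c) -> \sum_c wt c * f (w c) = \sum_c wt c * f c.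
Proof.
move=> wE; rewrite [RHS](reindex_inj (@perm_inj _ w)) /=.
by apply: eq_bigr => c _; rewrite wE.
Qed.

Lemma weight_swap_gt (I : finType) (wt f : I -> nat) (c d : I) :
    wt c < wt d -> f d < f c ->
  \sum_x wt x * f x < \sum_x wt x * f (tperm c d x).
Proof.
move=> wcd fdc; have ncd : c != d by apply: contraTneq wcd => ->; rewrite ltnn.
rewrite [X in X < _](bigD1 c) //= [X in _ < X](bigD1 c) //=.
rewrite [X in _ + X < _](bigD1 d) 1?eq_sym //=.
rewrite [X in _ < _ + X](bigD1 d) 1?eq_sym //=.
rewrite tpermL tpermR !addnA.
rewrite [X in _ < _ + X](eq_bigr (fun x => wt x * f x)); last first.
  by move=> x /andP[xc xd]; rewrite tpermD // eq_sym.
rewrite ltn_add2r; nia.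
Qed.

(** Rearrangement inequality with its equality case. A line-preserving [w] that
    maximizes the weighted sum makes [f \o w] monotone, since otherwise a swap
    would increase the sum; by uniqueness of the sorted rearrangement
    [f \o w = f], so the maximum is attained exactly by such [w]. *)
Lemma max_rearrangement (I : finType) (line pos f : I -> nat) :
    (forall c d, line c = line d -> pos c = pos d -> c = d) ->
    (forall c d, line c = line d -> pos c <= pos d -> f c <= f d) ->
  forall w : {perm I}, (forall c, line (w c) = line c) ->
    \sum_c pos c * f (w c) <= \sum_c pos c * f c /\
    (\sum_c pos c * f (w c) = \sum_c pos c * f c -> forall c, f (w c) = f c).
Proof.
move=> posI fM; pose P (w : {perm I}) := [forall c, line (w c) == line c].
pose W (w : {perm I}) := \sum_c pos c * f (w c).
have P1 : P 1%g by apply/forallP => c; rewrite perm1.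
case: (@arg_maxnP _ 1%g P W P1) => w0 Pw0 maxw0.
have maxE w : P w -> W w0 <= W w -> forall c, f (w c) = f c.
  move=> Pw Ww; apply: (@monotone_rearrangement _ line pos) => //.
    by move=> c; apply/eqP/(forallP Pw).
  move=> c d lcd; rewrite leq_eqVlt => /predU1P[/(posI _ _ lcd)-> // | pcd].
  rewrite leqNgt; apply/negP => fcd.
  have Pt : P (tperm c d * w)%g.
    apply/forallP => x; rewrite permM (eqP (forallP Pw _)).
    by case: tpermP => [->|->|]; rewrite ?lcd.
  have := leq_trans (maxw0 _ Pt) Ww; apply/negP; rewrite -ltnNge.
  rewrite {2}/W (eq_bigr (fun x => pos x * f (w (tperm c d x)))); last first.
    by move=> x _; rewrite permM.
  exact: (@weight_swap_gt _ pos (fun x => f (w x))).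
have W0 : W w0 = \sum_c pos c * f c.
  by apply: eq_bigr => c _; rewrite (maxE w0).
move=> w wl; have Pw : P w by apply/forallP => c; rewrite wl.
split; first by rewrite -W0; apply: maxw0.
by move=> WE; apply: maxE => //; rewrite /W WE -W0.
Qed.

(** Passing from [X] to [Y] replaces elements of value at most [v] by as many
    elements of value at least [v]. The equality case identifies the terms of a
    Garnir relation that do not change the content of the columns. *)
Lemma exchange_sum (I : finType) (X Y : {set I}) (f : I -> nat) (v : nat) :
    #|X| = #|Y| ->
    (forall x, x \in X :\: Y -> f x <= v) ->
    (forall y, y \in Y :\: X -> v <= f y) ->
  \sum_(x in X) f x <= \sum_(y in Y) f y /\
  (\sum_(x in X) f x = \sum_(y in Y) f y ->
    forall z, (z \in X :\: Y) || (z \in Y :\: X) -> f z = v).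
Proof.
move=> XY fX fY; have XY' : #|X :\: Y| = #|Y :\: X|.
  by apply: (@addnI #|X :&: Y|); rewrite cardsID XY setIC cardsID.
rewrite (big_setID Y) [X in _ <= X](big_setID X) [X in _ = X -> _](big_setID X).
rewrite /= [Y :&: X]setIC leq_add2l.
have leX : \sum_(x in X :\: Y) f x <= \sum_(x in X :\: Y) v
    ?= iff [forall (x | x \in X :\: Y), f x == v].
  by apply: leqif_sum => x /fX fx; apply/leqifP; case: ltngtP fx.
have leY : \sum_(x in Y :\: X) v <= \sum_(x in Y :\: X) f x
    ?= iff [forall (x | x \in Y :\: X), v == f x].
  by apply: leqif_sum => x /fY fx; apply/leqifP; case: ltngtP fx.
have vXY : \sum_(x in X :\: Y) v = \sum_(x in Y :\: X) v.
  by rewrite !sum_nat_const XY'.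
rewrite vXY in leX; have := leqif_trans leX leY => -[-> eqXY].
split=> // /addnI/eqP; rewrite eqXY => /andP[/forallP fXv /forallP fYv] z.
by case/orP=> zD; apply/eqP; [move: (fXv z) | move: (fYv z)];
  rewrite zD // eq_sym.
Qed.

End Combinatorics.

(** * Last-letter order as a total order on blocks *)

Section BlockOrder.

Lemma ll_lt_irr s : ll_lt s s = false.
Proof. by elim: s => //= u s ->; rewrite ltnn andbF. Qed.

Lemma ll_lt_trans : transitive ll_lt.
Proof.
elim=> [|u t IH] [|v s] [|w x] //= /orP[uv|/andP[/eqP-> st]]
  /orP[vw|/andP[/eqP E tx]]; rewrite -?E.
- by rewrite (ltn_trans uv vw).
- by rewrite uv.
- by rewrite vw.
by rewrite eqxx (IH _ _ st tx) orbT.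
Qed.

Lemma ll_lt_total s t : s != t -> ll_lt s t || ll_lt t s.
Proof.
elim: s t => [|u s IH] [|v t] //=; rewrite eqseq_cons.
by case: ltngtP => //= _ /IH.
Qed.

Lemma ll_le_refl : reflexive ll_le.
Proof. by move=> s; rewrite /ll_le eqxx. Qed.

Lemma ll_le_trans : transitive ll_le.
Proof.
move=> t s x /predU1P[-> //|st] /predU1P[<-|tx]; first by rewrite /ll_le st orbT.
by rewrite /ll_le (ll_lt_trans st tx) orbT.
Qed.

Lemma ll_le_anti : antisymmetric ll_le.
Proof.
move=> s t /andP[/predU1P[//|st] /predU1P[//|ts]].
by have := ll_lt_trans st ts; rewrite ll_lt_irr.
Qed.

Lemma ll_le_total : total ll_le.
Proof.
move=> s t; rewrite /ll_le [t == s]eq_sym.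
by case: eqP => //= /eqP /ll_lt_total.
Qed.

Variables k m r s : nat.
Local Notation mb := (mblock k m r s).
Implicit Types S R : mb.

Lemma count_mword S (x : 'I_(k + m)) : count_mem (x : nat) (mword S) = S x.
Proof.
rewrite /mword count_flatten -map_comp sumnE big_map.
rewrite big_rev /= big_enum /= (bigD1 x) //= count_nseq /= eqxx mul1n.
rewrite big1 ?addn0 // => y yx; rewrite count_nseq /=.
by rewrite (inj_eq val_inj) (negPf yx).
Qed.

Lemma mword_inj : injective (@mword k m r s).
Proof.
move=> S R SR; apply/ffunP => x; apply: val_inj.
by move: (count_mword S x) (count_mword R x); rewrite SR => -> .
Qed.

Lemma mword_empty : mword (empty_mblock k m r s) = [::].
Proof.
case E: (mword _) => [//|y w].
have /flattenP[_ /mapP[x _ ->]] : y \in mword (empty_mblock k m r s).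
  by rewrite E inE eqxx.
by rewrite ffunE.
Qed.

Lemma mle_refl : reflexive (@mle k m r s).
Proof. by move=> S; apply: ll_le_refl. Qed.

Lemma mle_trans : transitive (@mle k m r s).
Proof. by move=> S R Q; apply: ll_le_trans. Qed.

Lemma mle_anti : antisymmetric (@mle k m r s).
Proof. by move=> S R /ll_le_anti /mword_inj. Qed.

Lemma mle_total : total (@mle k m r s).
Proof. by move=> S R; apply: ll_le_total. Qed.

Lemma mle_empty S : mle (empty_mblock k m r s) S.
Proof. by rewrite /mle mword_empty /ll_le; case: (mword S). Qed.

(** The position of a block in the last-letter order, so that fillings can be
    compared through weighted sums of natural numbers. *)
Definition block_rank S : nat := #|[set R | mle R S && (R != S)]|.

Lemma block_rank_lt S R : mle S R -> S != R -> block_rank S < block_rank R.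
Proof.
move=> SR nSR; apply/proper_card/properP; split; last first.
  by exists S; rewrite !inE ?SR ?nSR // eqxx andbF.
apply/subsetP=> Q; rewrite !inE => /andP[QS nQS]; rewrite (mle_trans QS SR) /=.
by apply: contraNneq nSR => QR; apply/eqP/mle_anti; rewrite SR -QR QS.
Qed.

Lemma block_rank_le S R : (block_rank S <= block_rank R) = mle S R.
Proof.
have [->|nSR] := eqVneq S R; first by rewrite leqnn mle_refl.
case/orP: (mle_total S R) => le; first by rewrite le ltnW // block_rank_lt.
rewrite leqNgt block_rank_lt 1?eq_sym //=; apply/esym/negP => le'.
by case/eqP: nSR; apply: mle_anti; rewrite le le'.
Qed.

Lemma block_rank_inj : injective block_rank.
Proof.
by move=> S R SR; apply: mle_anti; rewrite -!block_rank_le SR leqnn.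
Qed.

End BlockOrder.

(** * Polytabloids and Garnir relations *)

Definition rearr (I : finType) (B : Type) (T : {ffun I -> B}) (w : {perm I}) :
  {ffun I -> B} := [ffun c => T (w c)].

Lemma rearrM (I : finType) (B : Type) (T : {ffun I -> B}) (w p : {perm I}) :
  rearr (rearr T w) p = rearr T (p * w)%g.
Proof. by apply/ffunP => c; rewrite !ffunE permM. Qed.

Lemma rearr1 (I : finType) (B : Type) (T : {ffun I -> B}) : rearr T 1%g = T.
Proof. by apply/ffunP => c; rewrite ffunE perm1. Qed.

Section Polytabloids.

Variables (la : seq nat).
Implicit Types (c d : box la) (p w : {perm box la}).

Lemma box_inj c d : box_row c = box_row d -> box_col c = box_col d -> c = d.
Proof.
case: c d => [i j] [i' j']; rewrite /box_row /box_col /= => /val_inj ii'.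
by case: i' / ii' j' => j' /val_inj ->.
Qed.

Lemma box_of (i j : nat) :
  i < size la -> j < nth 0 la i -> exists c, box_row c = i /\ box_col c = j.
Proof.
move=> lti ltj; pose i' := Ordinal lti.
by exists (Tagged (fun i : 'I_(size la) => 'I_(nth 0 la i)) (Ordinal ltj : 'I_(nth 0 la i'))).
Qed.

Lemma col_groupP p :
  reflect ((forall c, box_col (p c) = box_col c) /\
           (forall c, box_row c = 0 -> p c = c)) (p \in col_group la).
Proof.
rewrite inE; apply: (iffP forallP) => [H|[H1 H2] c]; last first.
  by rewrite H1 eqxx; apply/implyP => /eqP /H2 ->.
by split=> c; case/andP: (H c) => /eqP // _ /implyP H0 /eqP/H0/eqP.
Qed.

Lemma col_group_set : group_set (col_group la).
Proof.
apply/group_setP; split.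
  by apply/col_groupP; split=> c; rewrite perm1.
move=> p w /col_groupP[p1 p2] /col_groupP[w1 w2].
by apply/col_groupP; split=> c; rewrite permM ?w1 // => /[dup] /p2 -> /w2.
Qed.
Canonical col_group_group := Group col_group_set.

Lemma col_group_row p c :
  p \in col_group la -> (box_row (p c) == 0) = (box_row c == 0).
Proof.
case/col_groupP=> _ p0; apply/eqP/eqP => [pc0|c0]; last by rewrite p0.
by rewrite -(perm_inj (p0 _ pc0)).
Qed.

Lemma tperm_col c d : box_col c = box_col d -> 0 < box_row c ->
  0 < box_row d -> tperm c d \in col_group la.
Proof.
move=> cd c0 d0; apply/col_groupP; split=> x; case: tpermP => // ->//.
  by move=> x0; rewrite x0 in c0.
by move=> x0; rewrite x0 in d0.
Qed.

(** Pigeonhole: [A] and [B] together have one box more than the column of [c],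
    as both contain a box in the row of [c]. The preimages of [A] and [B] under a
    column permutation occupy rows of that column, as the column of [c'] is no
    longer than the column of [c], so they meet in some row. The two columns
    need not be adjacent. *)
Lemma column_collision c c' p : sorted geq la ->
    box_row c = box_row c' -> 0 < box_row c -> box_col c < box_col c' ->
    p \in col_group la ->
  let A := [set d | (box_col d == box_col c) && (box_row c <= box_row d)] in
  let B := [set d | [&& box_col d == box_col c', 0 < box_row d &
                        box_row d <= box_row c]] in
  exists d d', [/\ d != d', box_row d = box_row d', p d \in A & p d' \in B].
Proof.
move=> sla rcc' rc ltc pC A B; have [p1 p2] := col_groupP _ pC.
pose rows (X : {set box la}) := [set tag d | d in X].
pose J := [set d : box la | (box_col d == box_col c) && (0 < box_row d)].
have sub_geq i i' : i <= i' -> i' < size la -> nth 0 la i' <= nth 0 la i.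
  move=> ii' i's; have := @sorted_leq_nth _ geq _ _ 0 la sla i i'.
  by rewrite !inE; apply=> //; [move=> ? ? ? /= h h'; apply: leq_trans h |
     apply: leqnn | apply: leq_ltn_trans i's].
have rows_card (X : {set box la}) j :
    (forall d, d \in X -> box_col d = j) -> #|rows X| = #|X|.
  move=> Xj; apply: card_in_imset => d d' dX d'X dd'.
  by apply: box_inj; [rewrite /box_row dd' | rewrite !Xj].
have to_J d : 0 < box_row d -> box_col d = box_col c' -> tag d \in rows J.
  move=> d0 dc'; have [|x [xr xc]] := @box_of (tag d) (box_col c) (ltn_ord _).
    by apply: ltn_trans ltc _; rewrite -dc'; apply: ltn_ord.
  apply/imsetP; exists x; last by apply/val_inj.
  by rewrite inE xc eqxx xr.
pose A' := p @^-1: A; pose B' := p @^-1: B.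
have A'J : rows A' \subset rows J.
  apply/subsetP=> _ /imsetP[d + ->]; rewrite !inE p1 => /andP[dc rd].
  apply: imset_f; rewrite inE dc lt0n -(col_group_row _ pC) -lt0n.
  exact: leq_trans rc rd.
have B'J : rows B' \subset rows J.
  apply/subsetP=> _ /imsetP[d + ->]; rewrite !inE p1 => /and3P[/eqP dc rd _].
  by apply: to_J; rewrite // lt0n -(col_group_row _ pC) -lt0n.
(* As the rows of the diagram decrease in length, every row of the column of c
   up to the row of c also meets the column of c'. *)
have JAB : rows J \subset rows A :|: rows B.
  apply/subsetP=> _ /imsetP[d + ->]; rewrite !inE => /andP[/eqP dc rd].
  case: (leqP (box_row c) (box_row d)) => [cd|/ltnW cd].
    by apply/orP; left; apply: imset_f; rewrite inE dc eqxx.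
  apply/orP; right; have [|x [xr xc]] := @box_of (tag d) (box_col c') (ltn_ord _).
    apply: leq_trans (sub_geq _ _ cd (ltn_ord _)).
    by rewrite rcc' ltn_ord.
  apply/imsetP; exists x; last by apply/val_inj.
  by rewrite inE xc eqxx xr -/(box_row d) rd cd.
have iAB : tag c \in rows A :&: rows B.
  rewrite inE; apply/andP; split; first by apply: imset_f; rewrite inE eqxx /=.
  have -> : tag c = tag c' by apply/val_inj.
  by apply: imset_f; rewrite inE eqxx -rcc' rc /=.
(* Count: #A + #B exceeds the height of the column, which bounds #(rows A' :|: rows B'). *)
have : rows A' :&: rows B' != set0.
  rewrite -card_gt0 -(ltn_add2l #|rows A' :|: rows B'|) addn0 cardsUI.
  rewrite (@rows_card A' (box_col c)); last first.
    by move=> d; rewrite !inE p1 => /andP[/eqP].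
  rewrite (@rows_card B' (box_col c')); last first.
    by move=> d; rewrite !inE p1 => /andP[/eqP].
  rewrite !(card_preimset _ (@perm_inj _ p)).
  rewrite -(@rows_card A (box_col c)); last first.
    by move=> d; rewrite !inE => /andP[/eqP].
  rewrite -(@rows_card B (box_col c')); last first.
    by move=> d; rewrite !inE => /andP[/eqP].
  rewrite -[X in _ < X]cardsUI.
  have le1 : #|rows A' :|: rows B'| <= #|rows A :|: rows B|.
    apply: subset_leq_card; apply: subset_trans JAB.
    by rewrite subUset A'J.
  apply: leq_ltn_trans le1 _; rewrite -[X in X < _]addn0 ltn_add2l card_gt0.
  by apply/set0Pn; exists (tag c).
case/set0Pn => x; rewrite inE => /andP[/imsetP[d dA xd] /imsetP[d' dB xd']].
exists d, d'; split; last 1 first.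
- by rewrite inE in dB.
- apply: contraTneq dA => ->; rewrite !inE; apply/negP => /andP[/eqP e _].
  by move: dB ltc; rewrite !inE e => /andP[/eqP->]; rewrite ltnn.
- by rewrite /box_row -xd -xd'.
by rewrite inE in dA.
Qed.

Local Open Scope ring_scope.

Variables (q : nat) (K : fieldType).
Implicit Types T : set_tableau q la.

Lemma tabloid_row T w : (forall c, box_row (w c) = box_row c) ->
  tabloid_of (rearr T w) = tabloid_of T.
Proof.
move=> wr; have wt c : tag (w c) = tag c by apply/val_inj/wr.
apply/ffunP => i; rewrite !ffunE; apply/setP => B.
apply/imsetP/imsetP => [[c]|[c]]; rewrite !inE ?ffunE => cP ->.
  by exists (w c); rewrite // !inE wt.
exists (w^-1%g c); rewrite ?ffunE ?permKV // !inE ffunE permKV.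
by rewrite -(wt (w^-1%g c)) permKV.
Qed.

Lemma v_col T p : p \in col_group la ->
  v_ K (rearr T p) = (-1) ^+ (p : bool) *: v_ K T.
Proof.
move=> pC; rewrite /v_ scaler_sumr (reindex_inj (mulIg p^-1%g)) /=.
apply: eq_big => w; first by rewrite groupMr ?groupV.
move=> _; rewrite odd_permM odd_permV signr_addb scalerA mulrC; congr (_ *: _).
congr (tabloid_vec _ (tabloid_of _)).
by rewrite -/(rearr _ _) rearrM mulgKV.
Qed.

(** A permutation of the first row commutes with the column group, which fixes
    the first row, and does not change the underlying tabloid. *)
Lemma v_row0 T w : (forall c, (0 < box_row c)%N -> w c = c) ->
  v_ K (rearr T w) = v_ K T.
Proof.
move=> w0; have wr c : (box_row (w c) == 0%N) = (box_row c == 0%N).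
  apply/idP/idP; last first.
    apply: contraLR; rewrite -!lt0n => /[dup] wc /w0 /perm_inj e.
    by rewrite e in wc.
  by apply: contraLR; rewrite -!lt0n => /[dup] h /w0 ->.
apply: eq_bigr => p pC; congr (_ *: tabloid_vec _ _).
rewrite -/(rearr _ _) -/(rearr T _) rearrM.
have -> : (p * w)%g = (w * p)%g.
  apply/permP => c; rewrite !permM; have [_ p0] := col_groupP _ pC.
  have [c0|c0] := posnP (box_row c).
    by rewrite (p0 c c0) p0 //; apply/eqP; rewrite wr c0.
  by rewrite (w0 c c0) w0 // lt0n col_group_row // -lt0n.
rewrite -rearrM; apply: tabloid_row => c.
have [c0|/w0 -> //] := posnP (box_row c).
by apply/eqP; rewrite c0 wr c0.
Qed.

Hypothesis K0 : [pchar K] =i pred0.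

Lemma eq_opp_0 (V : lmodType K) (x : V) : x = - x -> x = 0.
Proof.
move=> /eqP; rewrite -addr_eq0 -mulr2n -scaler_nat scaler_eq0.
case/orP=> [|/eqP//]; move/pcharf0P: K0 => -> //.
Qed.

(** For each [p] in the column group the transposition of the boxes [p d] and
    [p d'] pairs the terms of the sum: it changes the sign, but not the tabloid,
    as the two boxes are brought into the same row. *)
Lemma garnir T (X : {set box la}) :
    (forall p, p \in col_group la -> exists d d',
       [/\ d != d', box_row d = box_row d', p d \in X & p d' \in X]) ->
  \sum_(w : {perm box la} | perm_on X w)
    (-1) ^+ (w : bool) *: v_ K (rearr T w) = 0.
Proof.
move=> XP; under eq_bigr do rewrite /v_ scaler_sumr.
rewrite exchange_big /= big1 // => p pC.
have [d [d' [dd' rd pd pd']]] := XP p pC.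
apply: eq_opp_0; rewrite {1}(reindex_inj (mulgI (tperm (p d) (p d')))) /=.
rewrite -sumrN; have tX : perm_on X (tperm (p d) (p d')).
  by apply/subsetP => x; rewrite inE; case: tpermP => [->|->|_ _ /eqP].
apply: eq_big => w.
  apply/idP/idP => h; last exact: perm_onM.
  by rewrite -(mulKg (tperm (p d) (p d')) w); apply: perm_onM; rewrite ?tpermV.
move=> _; rewrite odd_mul_tperm (inj_eq perm_inj) dd' signr_addb expr1.
rewrite mulN1r scaleNr; congr (- (_ *: (_ *: tabloid_vec _ _))).
rewrite -!/(rearr _ _) -!/(rearr T _) !rearrM -[RHS](@tabloid_row _ (tperm d d')).
  congr tabloid_of; rewrite rearrM; congr rearr; rewrite !mulgA; congr (_ * _)%g.
  by apply/permP => x; rewrite !permM inj_tperm //; apply: perm_inj.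
by move=> x; case: tpermP => // ->.
Qed.

End Polytabloids.

(** * The signed symmetrizer of the Young subgroup *)

Section Symmetrizer.

Variables (k m r s : nat) (a : k.-tuple nat) (b : m.-tuple nat).
Hypotheses (sum_a : sumn a = r) (sum_b : sumn b = s).
Local Notation kap := (@kappa k m r s a b).
Local Notation stable := (@kappa_stable k m r s a b).
Local Notation q := (r + s).

Lemma size_nseqs (f : nat -> nat) (l : seq nat) :
  size (flatten [seq nseq (f x) x | x <- l]) = sumn [seq f x | x <- l].
Proof. by elim: l => //= x l IH; rewrite size_cat size_nseq IH. Qed.

Let word := flatten [seq nseq (nth 0 (a ++ b) x) x | x <- iota 0 (k + m)].

(** Translates the distinction between plain and barred symbols into a bound on
    the letters that [kappa] maps to them. *)
Lemma word_split : exists w1 w2,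
  [/\ word = w1 ++ w2, size w1 = r, size w2 = s,
      all (fun x => x < k) w1 & all (fun x => k <= x < k + m) w2].
Proof.
pose W l := flatten [seq nseq (nth 0 (a ++ b) x) x | x <- l].
have allW (P : pred nat) l : all P l -> all P (W l).
  move/allP=> Pl; apply/allP => y /flattenP[_ /mapP[x xl ->]].
  by rewrite mem_nseq => /andP[_ /eqP->]; apply: Pl.
exists (W (iota 0 k)), (W (iota k m)); split.
- by rewrite /word iotaD map_cat flatten_cat.
- rewrite size_nseqs -sum_a; congr sumn; rewrite -[RHS](@mkseq_nth _ 0) size_tuple.
  by apply/eq_in_map => x; rewrite mem_iota nth_cat size_tuple => /= ->.
- rewrite size_nseqs -sum_b; congr sumn; rewrite -[RHS](@mkseq_nth _ 0) size_tuple.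
  rewrite -[X in iota X]addn0 iotaDl -map_comp; apply/eq_in_map => x _ /=.
  by rewrite nth_cat size_tuple ltnNge leq_addr addKn.
- by apply/allW/allP => x; rewrite mem_iota.
by apply/allW/allP => x; rewrite mem_iota.
Qed.

Lemma size_word : size word = q.
Proof. by have [w1 [w2 [-> <- <- _ _]]] := word_split; rewrite size_cat. Qed.

Lemma kappa_lt (i : 'I_q) : kap i < k + m.
Proof.
have : kap i \in word by rewrite mem_nth // size_word.
have [w1 [w2 [-> _ _ /allP h1 /allP h2]]] := word_split.
rewrite mem_cat => /orP[/h1|/h2 /andP[]//].
by move/leq_trans; apply; apply: leq_addr.
Qed.

Lemma kappa_barred (i : 'I_q) : (k <= kap i) = (r <= i).
Proof.
rewrite /kappa -/word; have := ltn_ord i; rewrite -{2}size_word.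
have [w1 [w2 [-> s1 _ /allP h1 /allP h2]]] := word_split.
rewrite size_cat s1 nth_cat s1; case: (leqP r i) => ri lti.
  by have /h2/andP[->] : nth 0 w2 (i - r) \in w2 by rewrite mem_nth // ltn_subLR.
by apply/negbTE; rewrite -ltnNge; apply/h1/mem_nth; rewrite s1.
Qed.

Definition letter (i : 'I_q) : 'I_(k + m) := Ordinal (kappa_lt i).

Lemma size_fibre (x : nat) :
  x < k + m -> size (fibre r s a b x) = nth 0 (a ++ b) x.
Proof.
move=> xkm; rewrite /fibre size_filter.
transitivity (count_mem x word).
  rewrite -[X in _ = count _ X](@mkseq_nth _ 0 word) size_word /mkseq -val_enum_ord.
  by rewrite -map_comp [RHS]count_map.
rewrite /word count_flatten sumnE !big_map (bigD1_seq x) ?iota_uniq ?mem_iota //=.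
rewrite count_nseq /= eqxx mul1n big1 ?addn0 // => y /negPf yx.
by rewrite count_nseq /= yx.
Qed.

Implicit Types (B C : {set 'I_q}) (g h u : {perm 'I_q}).

Lemma kappa_blockE B (x : 'I_(k + m)) :
  kappa_block a b B x = #|[set i in B | kap i == x]| :> nat.
Proof.
rewrite ffunE inordK // ltnS; apply: leq_trans (max_card _) _.
by rewrite card_ord.
Qed.

Lemma stableP g : reflect (forall i, kap (g i) = kap i) (stable g).
Proof. by apply: (iffP forallP) => H i; apply/eqP/H. Qed.

Definition stable_perms : {set {perm 'I_q}} := [set g | stable g].

Lemma stable_group_set : group_set stable_perms.
Proof.
apply/group_setP; split; first by rewrite inE; apply/stableP => i; rewrite perm1.
move=> g h; rewrite !inE => /stableP gP /stableP hP.
by apply/stableP => i; rewrite permM hP.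
Qed.
Canonical stable_group := Group stable_group_set.

Definition plain_letters : {set 'I_q} := [set i : 'I_q | i < r].
Definition barred_letters : {set 'I_q} := [set i : 'I_q | r <= i].

Lemma stable_plain_barred g : g \in stable_perms ->
  (g \in 'N(plain_letters | 'P)%g) && (g \in 'N(barred_letters | 'P)%g).
Proof.
rewrite inE => /stableP gP; apply/andP; split; apply/astabsP => i /=.
  by rewrite !inE apermE !ltnNge -!kappa_barred gP.
by rewrite !inE apermE -!kappa_barred gP.
Qed.

(** On the Young subgroup, the sign of the factor that permutes the barred
    letters. *)
Definition barred_sign g : bool := restr_perm barred_letters g.

Lemma barred_signM g h : g \in stable_perms -> h \in stable_perms ->
  barred_sign (g * h)%g = barred_sign g (+) barred_sign h.
Proof.
move=> /stable_plain_barred/andP[_ gN] /stable_plain_barred/andP[_ hN].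
by rewrite /barred_sign morphM //= odd_permM.
Qed.

Lemma barred_sign1 : barred_sign 1%g = false.
Proof. by rewrite /barred_sign morph1 odd_perm1. Qed.

Lemma restr_perm_id (S : {set 'I_q}) g : perm_on S g -> restr_perm S g = g.
Proof.
move=> gS; apply/permP => i; have [iS|iS] := boolP (i \in S).
  rewrite restr_permE //; apply/astabsP => j /=; rewrite apermE.
  exact: perm_closed.
by rewrite (out_perm (restr_perm_on _ _)) // (out_perm gS).
Qed.

Lemma restr_perm_triv (S S' : {set 'I_q}) g :
  perm_on S' g -> [disjoint S & S'] -> restr_perm S g = 1%g.
Proof.
move=> gS' dS; have gS i : i \in S -> g i = i.
  by move=> iS; apply: (out_perm gS'); rewrite (disjointFr dS).
apply/permP => i; rewrite perm1.
have [iS|iS] := boolP (i \in S); last by rewrite (out_perm (restr_perm_on _ _)).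
rewrite restr_permE ?gS //; apply/astabsP => j /=; rewrite apermE.
apply/idP/idP => [gj|jS]; last by rewrite gS.
by rewrite -(perm_inj (gS _ gj)).
Qed.

Lemma barred_sign_tperm i j : kap i = kap j -> i != j ->
  barred_sign (tperm i j) = (r <= i).
Proof.
move=> ij nij; rewrite /barred_sign.
have rij : (r <= i) = (r <= j) by rewrite -!kappa_barred ij.
case: (leqP r i) rij => ri rj.
  rewrite restr_perm_id ?odd_tperm ?nij //.
  by apply/subsetP=> x; rewrite !inE; case: tpermP => [->|->|_ _ /eqP].
rewrite (@restr_perm_triv _ plain_letters) ?odd_perm1 //.
  apply/subsetP=> x; rewrite !inE; case: tpermP => [->|->|_ _ /eqP] //.
  by rewrite ltnNge -rj.
by rewrite -setI_eq0; apply/eqP/setP => x; rewrite !inE ltnNge andbN.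
Qed.

Lemma tperm_stable i j : kap i = kap j -> tperm i j \in stable_perms.
Proof.
by move=> ij; rewrite inE; apply/stableP => x; case: tpermP => // ->.
Qed.

Local Open Scope ring_scope.

Variables (la : seq nat) (K : fieldType).
Local Notation V := (tabloid_space q la K).
Local Notation e := (e_ab r s a b la K).

Lemma tabloid_space_sum (x : V) : x = \sum_t x t *: tabloid_vec K t.
Proof.
apply/ffunP => t; rewrite sum_ffunE (bigD1 t) //= !ffunE eqxx.
rewrite big1 ?addr0 => [|t' t't]; first exact/esym/mulr1.
by rewrite !ffunE eq_sym (negPf t't) scaler0.
Qed.

Lemma perm_actM g h (x : V) :
  perm_act la K g (perm_act la K h x) = perm_act la K (h * g)%g x.
Proof.
rewrite [x]tabloid_space_sum !linear_sum; apply: eq_bigr => t _.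
rewrite !linearZ /= !perm_act_tabloid_vec; congr (_ *: tabloid_vec _ _).
apply/ffunP => i; rewrite !ffunE -imset_comp; apply: eq_imset => B /=.
by rewrite -imset_comp; apply: eq_imset => j; rewrite /= permM.
Qed.

(** Every element of the full Young subgroup is uniquely a product of a plain
    and a barred part, obtained by restriction, so the double sum defining [e] is
    a single sum over a group. The group structure is what makes [e] equivariant. *)
Lemma e_abE (x : V) :
  e x = (#|plain_young r s a b| * #|barred_young r s a b|)%:R^-1 *:
    \sum_(u in stable_perms) (-1) ^+ barred_sign u *: perm_act la K u x.
Proof.
rewrite /e_ab scale_lfunE; congr (_ *: _).
rewrite sum_lfunE; under eq_bigr do rewrite sum_lfunE.
rewrite pair_big /=.
pose f u := (restr_perm plain_letters u, restr_perm barred_letters u).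
pose f' (p : {perm 'I_q} * {perm 'I_q}) := (p.1 * p.2)%g.
have dpb : [disjoint barred_letters & plain_letters].
  by rewrite -setI_eq0; apply/eqP/setP => i; rewrite !inE ltnNge andbN.
have dbp : [disjoint plain_letters & barred_letters] by rewrite disjoint_sym.
have fK p : (p.1 \in plain_young r s a b) && (p.2 \in barred_young r s a b) ->
    f (f' p) = p.
  case: p => g h /=; rewrite !inE => /andP[/andP[gS gst] /andP[hS hst]].
  rewrite /f /f' /=; have gN : g \in stable_perms by rewrite inE.
  have hN : h \in stable_perms by rewrite inE.
  have /andP[gP gB] := stable_plain_barred gN.
  have /andP[hP hB] := stable_plain_barred hN.
  rewrite !morphM //= (restr_perm_id gS) (restr_perm_id hS).
  by rewrite (restr_perm_triv hS dbp) (restr_perm_triv gS dpb) mulg1 mul1g.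
rewrite (reindex_onto f f' fK) /=.
have stab_f u : u \in stable_perms ->
    [/\ restr_perm plain_letters u \in plain_young r s a b,
        restr_perm barred_letters u \in barred_young r s a b & f' (f u) = u].
  move=> uS; have /andP[uP uB] := stable_plain_barred uS.
  have /stableP ust : stable u by rewrite inE in uS.
  split.
  - rewrite inE restr_perm_on; apply/stableP => i.
    have [iS|iS] := boolP (i \in plain_letters); first by rewrite restr_permE.
    by rewrite (out_perm (restr_perm_on _ _)).
  - rewrite inE restr_perm_on; apply/stableP => i.
    have [iS|iS] := boolP (i \in barred_letters); first by rewrite restr_permE.
    by rewrite (out_perm (restr_perm_on _ _)).
  apply/permP => i; rewrite permM /=.
  have [iS|iS] := boolP (i \in plain_letters).
    rewrite [restr_perm plain_letters u i]restr_permE //.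
    rewrite (out_perm (restr_perm_on _ _)) // (disjointFl dpb) //.
    by have /= -> := astabsP uP i.
  rewrite [restr_perm plain_letters u i](out_perm (restr_perm_on _ _)) //.
  by rewrite restr_permE //; move: iS; rewrite !inE -leqNgt.
apply: eq_big => u.
  apply/idP/idP => [|uS]; last by have [-> -> ->] := stab_f u uS; rewrite eqxx.
  rewrite !inE => /andP[/andP[/andP[_ s1] /andP[_ s2]] /eqP fu].
  apply/stableP => i; rewrite -[u in LHS]fu permM.
  by move/stableP: s1 => s1; move/stableP: s2 => s2; rewrite s2 s1.
case/andP=> _ /eqP fu; rewrite scale_lfunE.
have -> : ((f u).1 * (f u).2)%g = u by exact: fu.
by [].
Qed.

Lemma e_stable g (x : V) : g \in stable_perms ->
  e (perm_act la K g x) = (-1) ^+ barred_sign g *: e x.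
Proof.
move=> gS; rewrite !e_abE scalerA mulrC -scalerA; congr (_ *: _).
rewrite scaler_sumr [RHS](reindex_inj (mulgI g)) /=; apply: eq_big => u.
  by rewrite groupMl.
move=> uS; rewrite perm_actM barred_signM // signr_addb scalerA mulrA.
by rewrite -signr_addb addbb mul1r.
Qed.

End Symmetrizer.

(** * Relabelling the entries of a tableau *)

Section Relabelling.

Variables (k m r s : nat) (a : k.-tuple nat) (b : m.-tuple nat).
Hypotheses (sum_a : sumn a = r) (sum_b : sumn b = s).
Local Notation kap := (@kappa k m r s a b).
Local Notation q := (r + s).
Local Notation stable := (stable_perms r s a b).
Implicit Types (B C : {set 'I_q}) (g h u : {perm 'I_q}).

Lemma kappa_blockP B C :
  kappa_block a b B = kappa_block a b C <->
  forall v, #|[set i in B | kap i == v]| = #|[set i in C | kap i == v]|.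
Proof.
split=> [BC v | H]; last first.
  by apply/ffunP => x; apply: val_inj; rewrite /= !kappa_blockE.
have [vkm|vkm] := ltnP v (k + m).
  by have := kappa_blockE a b B (Ordinal vkm); rewrite BC kappa_blockE.
rewrite !eq_card0 // => i; rewrite !inE; apply/negP => /andP[_ /eqP iv].
  by have := kappa_lt sum_a sum_b i; rewrite iv ltnNge vkm.
by have := kappa_lt sum_a sum_b i; rewrite iv ltnNge vkm.
Qed.

Lemma num_barred_kappa B :
  num_barred (kappa_block a b B) = #|[set i in B | r <= i]|.
Proof.
rewrite /num_barred; under eq_bigr do rewrite kappa_blockE.
rewrite -sum1dep_card (partition_big (letter sum_a sum_b) (@barred k m)) /=.
  apply: eq_bigr => x bx; rewrite -sum1dep_card; apply: eq_bigl => i.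
  rewrite -(inj_eq val_inj) /= -(kappa_barred sum_a sum_b).
  case: eqP => [->|_]; rewrite ?andbF // !andbT.
  by move: bx; rewrite /barred => ->; rewrite andbT.
by move=> i /andP[_]; rewrite /barred /= (kappa_barred sum_a sum_b).
Qed.

Lemma card_setD1_kappa B i v : i \in B ->
  #|[set j in B | kap j == v]| = (kap i == v) + #|[set j in B :\ i | kap j == v]|.
Proof.
move=> iB; rewrite (cardsD1 i) !inE iB /=; congr (_ + _).
by apply: eq_card => j; rewrite !inE andbA.
Qed.

(** Pair the letters of [B] and [C] with equal values of [kappa] and multiply
    the transpositions of the pairs; each pair of barred letters contributes a
    sign. *)
Lemma swap_blocks B C : [disjoint B & C] ->
    kappa_block a b B = kappa_block a b C ->
  exists g, [/\ g \in stable, g @: B = C, g @: C = B,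
    forall i, i \notin B -> i \notin C -> g i = i &
    barred_sign g = odd #|[set i in B | r <= i]|].
Proof.
suff main n : #|B| = n -> [disjoint B & C] ->
    kappa_block a b B = kappa_block a b C ->
  exists g, [/\ g \in stable, (forall i, i \in B -> g i \in C),
    (forall i, i \in C -> g i \in B),
    forall i, i \notin B -> i \notin C -> g i = i &
    barred_sign g = odd #|[set i in B | r <= i]|].
  move=> dBC kBC; have [g [gS gBC gCB gfix gs]] := main _ erefl dBC kBC.
  have sBC : g @: B \subset C by apply/subsetP=> _ /imsetP[i /gBC ? ->].
  have sCB : g @: C \subset B by apply/subsetP=> _ /imsetP[i /gCB ? ->].
  have cBC := subset_leq_card sBC; have cCB := subset_leq_card sCB.
  rewrite !(card_imset _ (@perm_inj _ g)) in cBC cCB.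
  exists g; split=> //; apply/eqP; rewrite eqEcard ?sBC ?sCB.
    by rewrite (card_imset _ (@perm_inj _ g)).
  by rewrite (card_imset _ (@perm_inj _ g)).
elim: n B C => [|n IH] B C.
  move/eqP; rewrite cards_eq0 => /eqP-> _ /kappa_blockP k0.
  have C0 : C = set0.
    apply/setP => i; rewrite inE; apply/negP => iC.
    have := k0 (kap i); rewrite (card_setD1_kappa _ iC) eqxx.
    by rewrite [LHS]eq_card0 // => j; rewrite !inE.
  exists 1%g; split; rewrite ?group1 ?C0 //.
  - by move=> i; rewrite inE.
  - by move=> i; rewrite inE.
  - by move=> i; rewrite perm1.
  rewrite barred_sign1 [X in odd X]eq_card0 // => i.
  by rewrite !inE.
move=> Bn dBC /kappa_blockP kBC.
have /card_gt0P[i iB] : 0 < #|B| by rewrite Bn.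
have /card_gt0P[j] : 0 < #|[set j in C | kap j == kap i]|.
  by rewrite -kBC (card_setD1_kappa _ iB) eqxx.
rewrite !inE => /andP[jC /eqP ji].
have niC : i \notin C by rewrite (disjointFr dBC).
have njB : j \notin B by rewrite (disjointFl dBC).
have nij : i != j by apply: contraNneq niC => ->.
have [||| g [gS gBC gCB gfix gs]] := IH (B :\ i) (C :\ j).
- by move: Bn; rewrite (cardsD1 i) iB => -[].
- by apply: disjointWl (subsetDl _ _) _; apply: disjointWr (subsetDl _ _) _.
- apply/kappa_blockP => v; have := kBC v.
  by rewrite (card_setD1_kappa _ iB) (card_setD1_kappa _ jC) ji => /addnI.
have gi : g i = i by apply: gfix; rewrite !inE ?eqxx // negb_and niC orbT.
have gj : g j = j by apply: gfix; rewrite !inE ?eqxx // negb_and njB orbT.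
have tS : tperm i j \in stable by apply: tperm_stable.
exists (g * tperm i j)%g; split; first exact: groupM.
- move=> x xB; rewrite permM; have [->|xi] := eqVneq x i.
    by rewrite gi tpermL.
  have : g x \in C :\ j by apply: gBC; rewrite !inE xi.
  rewrite !inE => /andP[gxj gxC]; rewrite tpermD // 1?eq_sym //.
  by apply: contraNneq niC => <-.
- move=> x xC; rewrite permM; have [->|xj] := eqVneq x j.
    by rewrite gj tpermR.
  have : g x \in B :\ i by apply: gCB; rewrite !inE xj.
  rewrite !inE => /andP[gxi gxB]; rewrite tpermD // 1?eq_sym //.
  by apply: contraNneq njB => <-.
- move=> x xB xC; rewrite permM gfix ?inE ?negb_and ?xB ?xC ?orbT //.
  by rewrite tpermD //; [apply: contraNneq xB => <- | apply: contraNneq xC => <-].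
rewrite (barred_signM sum_a sum_b gS tS) gs.
rewrite (barred_sign_tperm sum_a sum_b) //.
rewrite [in RHS](cardsD1 i) oddD !inE iB /= oddb addbC; congr (_ (+) odd _).
by apply: eq_card => x; rewrite !inE andbA.
Qed.

Variable la : seq nat.
Implicit Types (T : set_tableau q la) (c d : box la) (w : {perm box la}).

(** The multiset tableau of which [T] is a labelling. *)
Definition kappa_tableau T : mtableau k m r s la := [ffun c => kappa_block a b (T c)].

Definition blocks_disjoint T := forall c d, c != d -> [disjoint T c & T d].

Lemma set_tableau_disjoint T : is_set_tableau T -> blocks_disjoint T.
Proof.
case/andP=> _ /forallP H c d cd; rewrite -setI_eq0; apply/eqP/setP => i.
rewrite !inE; apply/negP => /andP[ic id_].
move: (H i); rewrite (bigD1 c) //= (bigD1 d) 1?eq_sym //= ic id_.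
by [].
Qed.

Lemma set_tableau_box T i : is_set_tableau T -> exists c, i \in T c.
Proof.
case/andP=> _ /forallP/(_ i) Hi; apply/existsP; apply: contraTT Hi.
move=> /existsPn H; rewrite big1 // => c _; by rewrite (negPf (H c)).
Qed.

Lemma perm_tableauM g h T :
  perm_tableau g (perm_tableau h T) = perm_tableau (h * g)%g T.
Proof.
apply/ffunP => c; rewrite !ffunE -imset_comp; apply: eq_imset => i.
by rewrite /= permM.
Qed.

Lemma rearr_perm g T w :
  rearr (perm_tableau g T) w = perm_tableau g (rearr T w).
Proof. by apply/ffunP => c; rewrite !ffunE. Qed.

Lemma kappa_tableau_rearr T w : kappa_tableau (rearr T w) = rearr (kappa_tableau T) w.
Proof. by apply/ffunP => c; rewrite !ffunE. Qed.

Lemma kappa_tableau_perm g T : g \in stable -> kappa_tableau (perm_tableau g T) = kappa_tableau T.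
Proof.
move=> gS; apply/ffunP => c; rewrite !ffunE; apply/kappa_blockP => v.
rewrite -(card_imset [set i in T c | _] (@perm_inj _ g)); apply: eq_card => i.
have /stableP gP : kappa_stable a b g by rewrite inE in gS.
rewrite !inE; apply/andP/imsetP => [[/imsetP[j jT ->] jv] | [j]].
  by exists j; rewrite // inE jT -gP.
by rewrite !inE => /andP[jT jv] ->; rewrite gP imset_f.
Qed.

Lemma swap_tableau T c d : blocks_disjoint T -> c != d -> kappa_tableau T c = kappa_tableau T d ->
  exists g, [/\ g \in stable, rearr T (tperm c d) = perm_tableau g T &
                barred_sign g = odd (num_barred (kappa_tableau T c))].
Proof.
move=> dT cd; rewrite !ffunE => /(swap_blocks (dT _ _ cd)).
case=> g [gS gc gd gfix gs].
exists g; split; rewrite // ?num_barred_kappa //.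
apply/ffunP => x; rewrite !ffunE; case: tpermP => [->|->|/eqP xc /eqP xd];
  rewrite ?gc ?gd //.
rewrite -[LHS]imset_id; apply: eq_in_imset => i ix; rewrite gfix //.
  by rewrite (disjointFr (dT _ _ xc)).
by rewrite (disjointFr (dT _ _ xd)).
Qed.

(** By induction on the number of moved boxes, [w] is a product of swaps of boxes
    whose blocks have the same image, each contributing the sign given by the
    parity [beta]: such permutations act by their sign on odd blocks and trivially
    on even ones. *)
Lemma box_perm_sign T w (beta : bool) : blocks_disjoint T ->
    rearr (kappa_tableau T) w = kappa_tableau T ->
    (forall c, w c != c -> odd (num_barred (kappa_tableau T c)) = beta) ->
  exists g, [/\ g \in stable, rearr T w = perm_tableau g T &
                barred_sign g = beta && odd_perm w].
Proof.
move: {2}#|_| (leqnn #|[set c | w c != c]|) => n.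
elim: n w => [|n IH] w.
  rewrite leqn0 cards_eq0 => /eqP/setP w0 dT wT par.
  have -> : w = 1%g.
    by apply/permP => c; move: (w0 c); rewrite !inE perm1 => /negbFE/eqP.
  exists 1%g; split; rewrite ?group1 ?barred_sign1 ?odd_perm1 ?andbF //.
  rewrite rearr1; apply/ffunP => c; rewrite ffunE -[LHS]imset_id.
  by apply: eq_imset => i; rewrite perm1.
move=> wn dT wT par.
have [/existsP[c wc]|/existsPn w1] := boolP [exists c, w c != c]; last first.
  apply: IH => //; rewrite eq_card0 // => c; rewrite inE.
  exact/negbTE/w1.
have kcd : kappa_tableau T c = kappa_tableau T (w c) by rewrite -{1}wT ffunE.
have cd : c != w c by rewrite eq_sym.
have [g1 [g1S g1T g1s]] := swap_tableau dT cd kcd.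
pose t := tperm c (w c); pose w' := (w * t)%g.
have w'T : rearr (kappa_tableau T) w' = kappa_tableau T.
  apply/ffunP => x; have wx : kappa_tableau T (w x) = kappa_tableau T x.
    by have /ffunP/(_ x) := wT; rewrite [LHS]ffunE.
  by rewrite ffunE permM -wx /t; case: tpermP => // ->; rewrite kcd.
have w'mv x : w' x != x -> w x != x.
  apply: contraNneq => wx.
  have cx : c != x by apply: contraNneq wc => ->; rewrite wx.
  have wcx : w c != x.
    by apply: contraNneq cx => wcx; apply/eqP/(@perm_inj _ w); rewrite wx.
  by rewrite /w' permM wx tpermD.
have [||||g [gS gT gs]] := IH w' => //.
- rewrite -ltnS (leq_trans _ wn) // proper_card //; apply/properP; split.
    by apply/subsetP=> x; rewrite !inE; apply: w'mv.
  by exists c; rewrite !inE // permM tpermR eqxx.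
- by move=> x /w'mv; apply: par.
exists (g * g1)%g; split; first exact: groupM.
  have -> : w = (w' * t)%g by rewrite /w' -mulgA tperm2 mulg1.
  by rewrite -rearrM g1T rearr_perm gT perm_tableauM.
rewrite (barred_signM sum_a sum_b) // gs g1s par // /w' odd_permM odd_tperm cd.
by case: (beta) (odd_perm w) => [] [].
Qed.

(** In both tableaux each box contains equally many letters with a given value
    of [kappa]; matching these letters gives the relabelling. *)
Lemma relabel_tableau T T' : is_set_tableau T -> is_set_tableau T' ->
  kappa_tableau T = kappa_tableau T' -> exists2 g, g \in stable & T = perm_tableau g T'.
Proof.
move=> sT sT' kTT'.
pose f (T0 : set_tableau q la) (i : 'I_q) := (kap i, [pick c | i \in T0 c]).
have pickE T0 i c : is_set_tableau T0 -> ([pick c | i \in T0 c] == Some c) = (i \in T0 c).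
  move=> sT0; case: pickP => [d id_|no]; last first.
    by have [d] := set_tableau_box i sT0; rewrite no.
  apply/eqP/idP => [[<-] // | ic]; congr Some; apply/eqP; apply: contraLR ic.
  by move/(set_tableau_disjoint sT0) => /disjointFr ->.
have [g gP] : exists g : {perm 'I_q}, forall i, f T (g i) = f T' i.
  apply: perm_of_card_fibres => -[v [c|]]; last first.
    rewrite !eq_card0 // => i; rewrite !inE xpair_eqE; apply/negP=> /andP[_].
      by case: pickP => // no; have [d] := set_tableau_box i sT'; rewrite no.
    by case: pickP => // no; have [d] := set_tableau_box i sT; rewrite no.
  have /ffunP/(_ c) := kTT'; rewrite !ffunE => /kappa_blockP/(_ v) H.
  transitivity #|[set i in T c | kap i == v]|.
    by apply: eq_card => i; rewrite !inE xpair_eqE pickE // andbC.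
  by rewrite H; apply: eq_card => i; rewrite !inE xpair_eqE pickE // andbC.
exists g.
  by rewrite inE; apply/stableP => i; have [] := gP i.
have gc i c : i \in T' c -> g i \in T c.
  by move=> ic; rewrite -pickE //; have [_ ->] := gP i; rewrite pickE.
apply/ffunP => c; rewrite ffunE; apply/setP => x.
apply/idP/imsetP => [xc|[i ic ->]]; last exact: gc.
exists (g^-1%g x); rewrite ?permKV //.
have [d xd] := set_tableau_box (g^-1%g x) sT'; have := gc _ _ xd; rewrite permKV.
have [-> //|cd] := eqVneq c d.
by rewrite (disjointFr (set_tableau_disjoint sT cd) xc).
Qed.

End Relabelling.

(** * Box permutations and their signs *)

(** Only the boxes of [A] and [B] change weight, and only if they cross from one
    column to the other. The negative terms have been moved to the other side to
    stay within the natural numbers. *)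
Lemma weight_column_exchange (I : finType) (wt f : I -> nat) (A B : {set I})
    (j j' : nat) (w : {perm I}) :
    j <= j' -> (forall d, d \in A -> wt d = j) -> (forall d, d \in B -> wt d = j') ->
    [disjoint A & B] -> perm_on (A :|: B) w ->
  \sum_d wt d * f (w d) + (j' - j) * \sum_(d in B) f d =
  \sum_d wt d * f d + (j' - j) * \sum_(d in w @: B) f d.
Proof.
move=> jj' wtA wtB dAB wAB.
rewrite (reindex_inj (@perm_inj _ w^-1%g)) /=.
rewrite [\sum_(d in B) _]big_mkcond [\sum_(d in _ @: _) _]big_mkcond.
rewrite !big_distrr -!big_split; apply: eq_bigr => d _ /=.
rewrite permKV; have -> : (d \in w @: B) = (w^-1%g d \in B).
  by rewrite -{1}(permKV w d) mem_imset //; apply: perm_inj.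
have wtAB x : x \in A :|: B -> wt x + (j' - j) * ~~ (x \in B) = j'.
  rewrite inE; have [xB|xB] := boolP (x \in B); first by rewrite muln0 addn0 wtB.
  by rewrite orbF => /wtA ->; rewrite muln1 subnKC.
have [dAB'|dAB'] := boolP (d \in A :|: B); last first.
  have wd : w^-1%g d = d by apply: (out_perm (perm_onV wAB)).
  by rewrite wd.
have := wtAB d dAB'; have := wtAB (w^-1%g d).
rewrite (perm_closed _ (perm_onV wAB)) => /(_ dAB').
by case: (_ \in B) => /=; case: (_ \in B) => /=; nia.
Qed.

Section SignedExchange.

Variables (k m r s : nat) (a : k.-tuple nat) (b : m.-tuple nat).
Hypotheses (sum_a : sumn a = r) (sum_b : sumn b = s).
Local Notation q := (r + s).
Local Notation stable := (stable_perms r s a b).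

Variables (la : seq nat) (K : fieldType).
Local Notation e := (e_ab r s a b la K).
Local Notation kt := (@kappa_tableau k m r s a b la).
Implicit Types (T : set_tableau q la) (c d : box la) (w : {perm box la}).

Lemma is_set_tableau_perm g T :
  is_set_tableau T -> is_set_tableau (perm_tableau g T).
Proof.
case/andP=> /andP[/forallP S1 /forallP S2] /forallP S3.
have g0 (B : {set 'I_q}) : (g @: B == set0) = (B == set0).
  by rewrite -!cards_eq0 card_imset //; apply: perm_inj.
apply/andP; split; first by apply/andP; split;
  apply/forallP => c; rewrite ffunE g0; [apply: S1 | apply: S2].
apply/forallP => i; rewrite -(eqP (S3 (g^-1%g i))); apply/eqP/eq_bigr => c _.
by rewrite ffunE -{1}(permKV g i) mem_imset //; apply: perm_inj.
Qed.

Lemma is_set_tableau_rearr w T : is_set_tableau T ->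
  tableau_shape set0 (rearr T w) -> is_set_tableau (rearr T w).
Proof.
case/andP=> _ /forallP S3 sh; rewrite /is_set_tableau sh; apply/forallP => i.
rewrite -(eqP (S3 i)) [X in _ == X](reindex_inj (@perm_inj _ w)) /=.
by apply/eqP/eq_bigr => c _; rewrite ffunE.
Qed.

(** Only the first row may contain empty boxes, so that rearranging the boxes
    above it preserves the shape condition. *)
Lemma is_set_tableau_upper w T : is_set_tableau T ->
    (forall c, box_row c = 0 -> w c = c) -> is_set_tableau (rearr T w).
Proof.
move=> sT w0; apply: is_set_tableau_rearr => //.
case/andP: sT => /andP[/forallP S1 /forallP S2] _.
have wr c : 0 < box_row c -> 0 < box_row (w c).
  by rewrite !lt0n; apply: contraNneq => /[dup] h /w0 /perm_inj e; rewrite -e h.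
apply/andP; split; apply/forallP => c; rewrite ffunE; apply/implyP.
  by move=> /wr h; apply: (implyP (S1 _)).
by case/andP=> /eqP c0 lc; rewrite w0 //; apply: (implyP (S2 _)); rewrite c0.
Qed.

Lemma kappa_block_empty (B : {set 'I_q}) :
  (kappa_block a b B == empty_mblock k m r s) = (B == set0).
Proof.
apply/eqP/eqP => [|->]; last first.
  apply/ffunP => x; apply: val_inj; rewrite /= kappa_blockE ffunE /=.
  by rewrite eq_card0 // => i; rewrite !inE.
move=> kB; apply/setP => i; rewrite inE; apply/negP => iB.
have := kappa_blockE a b B (letter sum_a sum_b i).
rewrite kB ffunE /= => /esym/eqP; rewrite cards_eq0 => /eqP/setP/(_ i).
by rewrite !inE iB eqxx.
Qed.

Lemma kappa_tableau_shape T :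
  tableau_shape (empty_mblock k m r s) (kt T) = tableau_shape set0 T.
Proof.
by congr (_ && _); apply: eq_forallb => c; rewrite ffunE kappa_block_empty.
Qed.

Lemma kappa_tableau_MT T : is_set_tableau T ->
    (forall c (x : 'I_(k + m)), barred x -> kt T c x <= 1) ->
  kt T \in MT r s a b la.
Proof.
move=> sT bT; rewrite inE kappa_tableau_shape; apply/and3P; split.
- by case/andP: sT.
- apply/forallP => x; rewrite -(size_fibre sum_a sum_b (ltn_ord x)) /fibre.
  under eq_bigr do rewrite ffunE kappa_blockE -sum1dep_card.
  under eq_bigr do rewrite big_mkcondl.
  rewrite exchange_big /= size_filter -sum1_count big_enum_cond /=.
  apply/eqP/eq_big => // i _; case/andP: sT => _ /forallP/(_ i)/eqP {2}<-.
  by apply: eq_bigr => c _; case: (i \in T c).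
by apply/forallP => c; apply/forallP => x; apply/implyP => /bT.
Qed.

Local Open Scope ring_scope.

Lemma e_v_perm g T : g \in stable ->
  e (v_ K (perm_tableau g T)) = (-1) ^+ barred_sign g *: e (v_ K T).
Proof. by move=> gS; rewrite -perm_act_v e_stable. Qed.

(** If [w] exchanges no box between the two columns it is a column permutation.
    Otherwise one exchanged box of each column is swapped back: this changes the
    sign of [w], and, the two blocks being equal and odd, also the sign of the
    vector. *)
Lemma exchange_sign T (A B : {set box la}) (j j' : nat) (u : mblock k m r s) w :
    blocks_disjoint T ->
    (forall d, d \in A -> box_col d = j /\ (0 < box_row d)%N) ->
    (forall d, d \in B -> box_col d = j' /\ (0 < box_row d)%N) ->
    [disjoint A & B] -> perm_on (A :|: B) w ->
    (forall z, (z \in B :\: w @: B) || (z \in w @: B :\: B) ->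
       kt T z = u /\ odd (num_barred u)) ->
  (-1) ^+ (w : bool) *: e (v_ K (rearr T w)) = e (v_ K T).
Proof.
move=> dT HA HB dAB; move: {2}#|_| (erefl #|w @: B :\: B|) => n.
elim: n w => [|n IH] w.
  move/eqP; rewrite cards_eq0 setD_eq0 => wB wAB _.
  have {}wB : w @: B = B.
    by apply/eqP; rewrite eqEcard wB card_imset ?leqnn //; apply: perm_inj.
  have memB x : (w x \in B) = (x \in B).
    by rewrite -{1}wB mem_imset //; apply: perm_inj.
  have wC : w \in col_group la.
    apply/col_groupP; split=> c; last first.
      move=> c0; apply: (out_perm wAB); rewrite inE; apply/negP.
      by case/orP=> [/HA|/HB]; rewrite c0 => -[].
    have [cAB|cAB] := boolP (c \in A :|: B); last by rewrite (out_perm wAB).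
    have := cAB; rewrite -(perm_closed c wAB) inE memB; move: cAB; rewrite inE.
    have [cB|cB] := boolP (c \in B).
      by move=> _ _; have [-> _] := HB _ cB; have [] := HB (w c); rewrite ?memB.
    by rewrite !orbF => /HA[-> _] /HA[-> _].
  rewrite v_col // linearZ /= scalerA -signr_addb addbb.
  by rewrite scale1r.
move=> wn wAB Hu.
have cBw : #|B| = #|w @: B| by rewrite card_imset //; apply: perm_inj.
have /card_gt0P[d dP] : (0 < #|w @: B :\: B|)%N by rewrite wn.
have /card_gt0P[d' d'P] : (0 < #|B :\: w @: B|)%N.
  suff -> : #|B :\: w @: B| = #|w @: B :\: B| by rewrite wn.
  by apply: (@addnI #|B :&: w @: B|); rewrite cardsID cBw setIC cardsID.
have [kd uodd] : kt T d = u /\ odd (num_barred u) by apply: Hu; rewrite dP orbT.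
have [kd' _] : kt T d' = u /\ odd (num_barred u) by apply: Hu; rewrite d'P.
move: (dP) (d'P); rewrite !in_setD => /andP[dB dw] /andP[d'w d'B].
have dd' : d != d' by apply: contraNneq dB => ->.
pose t := tperm d d'; pose w' := (w * t)%g.
have memw' x : (x \in w' @: B) = (t x \in w @: B).
  rewrite -[x in LHS](tpermK d d') -/t.
  have -> : w' @: B = t @: (w @: B).
    by rewrite -imset_comp; apply: eq_imset => y; rewrite /= permM.
  by rewrite mem_imset //; apply: perm_inj.
have tAB : perm_on (A :|: B) t.
  apply/subsetP => x; rewrite inE /t; case: tpermP => [->|->|_ _ /eqP//] _.
    by case/imsetP: dw => y yB ->; rewrite (perm_closed _ wAB) inE yB orbT.
  by rewrite inE d'B orbT.
have w'AB : perm_on (A :|: B) w' by apply: perm_onM.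
have [|g [gS gT gs]] := swap_tableau sum_a sum_b dT dd'; first by rewrite kd kd'.
have -> : w = (w' * t)%g by rewrite /w' -mulgA tperm2 mulg1.
rewrite -rearrM gT rearr_perm e_v_perm // gs kd uodd scalerA.
rewrite odd_permM odd_tperm dd' -signr_addb addbT /= addbT negbK.
apply: IH => //.
  apply/eqP; rewrite -eqSS -wn (cardsD1 d (w @: B :\: B)) dP eqSS; apply/eqP.
  apply: eq_card => x; rewrite !in_setD in_set1 memw' /t.
  case: tpermP => [->|->|/eqP xd /eqP xd'].
  - by rewrite eqxx (negPf d'w) !andbF.
  - by rewrite d'B andbF.
  by rewrite xd.
move=> z zP; apply: Hu; move: zP; rewrite !in_setD !memw' /t.
case: tpermP => [->|->|_ _ //].
  by rewrite (negPf dB) (negPf d'w) andbF.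
by rewrite d'B dw.
Qed.

End SignedExchange.

(** * Straightening *)

Section Straightening.

Variables (k m r s : nat) (a : k.-tuple nat) (b : m.-tuple nat).
Hypotheses (sum_a : sumn a = r) (sum_b : sumn b = s).
Local Notation q := (r + s).
Local Notation stable := (stable_perms r s a b).

Variables (la : seq nat) (K : fieldType).
Hypotheses (la_sorted : sorted geq la) (K0 : [pchar K]%R =i pred0).
Local Notation V := (tabloid_space q la K).
Local Notation e := (e_ab r s a b la K).
Local Notation kt := (@kappa_tableau k m r s a b la).
Implicit Types (T : set_tableau q la) (c d : box la) (w : {perm box la}).
Local Open Scope ring_scope.

(** The weight of the first row is zero, since permuting it must leave the
    primary measure unchanged. *)
Definition col_weight c : nat := if box_row c == 0%N then 0%N else box_col c.

(** In its part above the first row this weight detects unsorted columns, in the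
    first row an unsorted row. *)
Definition reading_weight c : nat :=
  if box_row c == 0%N then box_col c else box_row c.

Definition col_measure T : nat :=
  (\sum_c col_weight c * block_rank (kt T c))%N.

Definition reading_measure T : nat :=
  (\sum_c reading_weight c * block_rank (kt T c))%N.

Definition reading_bound : nat :=
  (\sum_c reading_weight c * #|mblock k m r s|).+1%N.

(** Lexicographic combination of the two measures: a Garnir relation increases
    the first one, with no control on the second, and a swap within a column or
    within the first row increases the second one and preserves the first. *)
Definition straightening_measure T : nat :=
  (col_measure T * reading_bound + reading_measure T)%N.

Lemma reading_measure_lt T : (reading_measure T < reading_bound)%N.
Proof.
by rewrite ltnS; apply: leq_sum => c _; rewrite leq_mul2l max_card orbT.
Qed.

Lemma measure_col_lt T T' : (col_measure T < col_measure T')%N ->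
  (straightening_measure T < straightening_measure T')%N.
Proof.
move=> lt; have := reading_measure_lt T; rewrite /straightening_measure.
by move: lt; nia.
Qed.

Lemma measure_reading_lt T T' : col_measure T = col_measure T' ->
  (reading_measure T < reading_measure T')%N ->
  (straightening_measure T < straightening_measure T')%N.
Proof. by rewrite /straightening_measure => ->; rewrite ltn_add2l. Qed.

Lemma measure_rearr (wt : box la -> nat) T w :
  (\sum_c wt c * block_rank (kt (rearr T w) c) =
   \sum_c wt c * block_rank (kt T (w c)))%N.
Proof. by apply: eq_bigr => c _; rewrite kappa_tableau_rearr ffunE. Qed.

Lemma swap_measure T c d : col_weight c = col_weight d ->
    (reading_weight c < reading_weight d)%N ->
    ~~ mle (kt T c) (kt T d) ->
  (straightening_measure T < straightening_measure (rearr T (tperm c d)))%N.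
Proof.
move=> wcd lcd; rewrite -block_rank_le -ltnNge => rcd.
apply: measure_reading_lt; last first.
  rewrite /reading_measure measure_rearr.
  exact: (@weight_swap_gt _ reading_weight (fun x => block_rank (kt T x))).
rewrite /col_measure measure_rearr.
rewrite (@weight_perm _ _ (fun x => block_rank (kt T x))) // => x.
by case: tpermP => // ->.
Qed.

(** The proof considers a counterexample [T] of maximal measure. Each way in
    which its image may fail to be semistandard expresses [e v_T] as zero or
    through tableaux of larger measure. *)
Lemma straighten (W : {vspace V}) :
    (forall T, is_set_tableau T -> kt T \in SSMT r s a b la -> e (v_ K T) \in W) ->
  forall T, is_set_tableau T -> e (v_ K T) \in W.
Proof.
move=> HW T0 sT0; apply/negPn/negP => bad0.
pose bad T := is_set_tableau T && (e (v_ K T) \notin W).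
have : bad T0 by apply/andP.
case/(@arg_maxnP _ T0 bad straightening_measure) => T /andP[sT badT] maxT {T0 sT0 bad0}.
have good T' : is_set_tableau T' ->
    (straightening_measure T < straightening_measure T')%N -> e (v_ K T') \in W.
  move=> sT' lt; apply/negPn/negP => badT'; have /= := maxT T'.
  by rewrite /bad sT' badT' => /(_ isT); rewrite leqNgt lt.
have dT := set_tableau_disjoint sT.
have zero : e (v_ K T) <> 0 by move=> e0; rewrite e0 mem0v in badT.
(* If i and j are barred letters of one block with the same image, then
   tperm i j fixes T but has sign -1. *)
have barred_le1 c (x : 'I_(k + m)) : barred x -> (kt T c x <= 1)%N.
  move=> bx; rewrite leqNgt; apply/negP; rewrite ffunE kappa_blockE.
  case/card_gt1P=> i [j [+ + nij]].
  rewrite !inE => /andP[iT /eqP ix] /andP[jT /eqP jx]; apply: zero.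
  have tS : tperm i j \in stable by apply: tperm_stable; rewrite ix jx.
  apply: eq_opp_0 => //; rewrite -[v_ K T in LHS](_ : v_ K (perm_tableau (tperm i j) T) = _).
    rewrite (e_v_perm sum_a sum_b) // (barred_sign_tperm sum_a sum_b) // ?ix ?jx //.
    by rewrite -(kappa_barred sum_a sum_b i) ix -/(barred x) bx expr1 scaleN1r.
  congr v_; apply/ffunP => d; rewrite ffunE; apply/setP => y.
  have mem z : (tperm i j z \in T d) = (z \in T d).
    case: tpermP => // ->; have [->|dc] := eqVneq d c; rewrite ?iT ?jT //.
    - by rewrite !(disjointFl (dT _ _ dc)).
    by rewrite !(disjointFl (dT _ _ dc)).
  by rewrite -[y in LHS](tpermK i j) mem_imset ?mem //; apply: perm_inj.
have swapE c d : c != d -> kt T c = kt T d ->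
    e (v_ K (rearr T (tperm c d))) = (-1) ^+ odd (num_barred (kt T c)) *: e (v_ K T).
  move=> cd kcd; have [g [gS -> gs]] := swap_tableau sum_a sum_b dT cd kcd.
  by rewrite (e_v_perm sum_a sum_b) // gs.
have columns c d : box_col c = box_col d -> (0 < box_row c < box_row d)%N ->
    mle (kt T c) (kt T d) && ((kt T c == kt T d) ==> odd (num_barred (kt T c))).
  move=> ccd /andP[c0 rcd]; have cd : c != d.
    by apply: contraTneq rcd => ->; rewrite ltnn.
  have d0 := ltn_trans c0 rcd; have tC := tperm_col ccd c0 d0.
  have vE : v_ K (rearr T (tperm c d)) = - v_ K T.
    by rewrite v_col // odd_tperm cd expr1 scaleN1r.
  have eE : e (v_ K (rearr T (tperm c d))) = - e (v_ K T) by rewrite vE linearN.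
  apply/andP; split.
    apply/negPn/negP => ncd; case/negP: badT.
    rewrite -memvN -eE; apply: good.
      apply: is_set_tableau_upper => // x x0.
      by have /col_groupP[_] := tC; apply.
    apply: swap_measure => //.
      by rewrite /col_weight (gtn_eqF c0) (gtn_eqF d0).
    by rewrite /reading_weight (gtn_eqF c0) (gtn_eqF d0).
  apply/implyP => /eqP kcd; apply/negPn/negP => even; apply: zero.
  apply: eq_opp_0 => //; rewrite -eE swapE // (negPf even).
  by rewrite expr0 scale1r.
have row0 c d : box_row c = 0%N -> box_row d = 0%N -> (box_col c < box_col d)%N ->
    mle (kt T c) (kt T d) && ((kt T c == kt T d) ==> ~~ odd (num_barred (kt T c))).
  move=> c0 d0 lcd; have cd : c != d.
    by apply: contraTneq lcd => ->; rewrite ltnn.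
  have vE : v_ K (rearr T (tperm c d)) = v_ K T.
    by apply: v_row0 => x x0; rewrite tpermD //; apply: contraTneq x0 => <-;
       rewrite ?c0 ?d0.
  apply/andP; split.
    apply/negPn/negP => ncd; case/negP: badT; rewrite -vE; apply: good.
      apply: is_set_tableau_rearr => //.
      have /andP[/andP[/forallP S1 /forallP S2] _] := sT.
      have lc : (nth 0%N la 1 <= box_col c)%N.
        rewrite leqNgt; apply: contra ncd => lc.
        have /implyP := S2 c; rewrite c0 lc => /(_ isT) Tc0.
        have /eqP -> : kt T c == empty_mblock k m r s.
          by rewrite ffunE kappa_block_empty.
        exact: mle_empty.
      apply/andP; split; apply/forallP => x; rewrite ffunE; case: tpermP => //.
      - by move->; rewrite c0.
      - by move->; rewrite d0.
      - by move->; rewrite c0 ltnNge lc.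
      by move->; rewrite d0 ltnNge (leq_trans lc (ltnW lcd)).
    by apply: swap_measure; rewrite // /col_weight /reading_weight c0 d0.
  apply/implyP => /eqP kcd; apply/negP => od; apply: zero.
  by apply: eq_opp_0 => //; rewrite -{1}vE swapE // od expr1 scaleN1r.
(* Garnir relation for a violation at c and d. The violation and the sorted
   columns give f x >= f c >= f d >= f y for x in A and y in B. *)
have rows c d : box_row c = box_row d -> (0 < box_row c)%N -> (box_col c < box_col d)%N ->
    mle (kt T c) (kt T d) && ((kt T c == kt T d) ==> ~~ odd (num_barred (kt T c))).
  move=> rcd c0 lcd; apply/negPn/negP; rewrite negb_and negb_imply negbK => viol.
  pose A := [set x : box la | (box_col x == box_col c) && (box_row c <= box_row x)%N].
  pose B := [set x : box la | [&& box_col x == box_col d, (0 < box_row x)%N &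
                         (box_row x <= box_row c)%N]].
  pose f x := block_rank (kt T x).
  have HA x : x \in A -> box_col x = box_col c /\ (0 < box_row x)%N.
    by rewrite inE => /andP[/eqP-> h]; split=> //; apply: leq_trans h.
  have HB x : x \in B -> box_col x = box_col d /\ (0 < box_row x)%N.
    by rewrite inE => /and3P[/eqP->].
  have cA : c \in A by rewrite inE eqxx leqnn.
  have dB : d \in B by rewrite inE eqxx -rcd c0 leqnn.
  have fdc : (f d <= f c)%N.
    rewrite /f; case/orP: viol => [|/andP[/eqP-> //]].
    by rewrite -block_rank_le -ltnNge => /ltnW.
  have fA x : x \in A -> (f c <= f x)%N.
    rewrite inE => /andP[/eqP xc]; rewrite leq_eqVlt => /predU1P[rx|rx].
      by rewrite (box_inj rx) // xc.
    rewrite /f block_rank_le; have := columns c x (esym xc).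
    by rewrite c0 rx => /(_ isT) /andP[].
  have fB x : x \in B -> (f x <= f d)%N.
    rewrite inE => /and3P[/eqP xd x0]; rewrite rcd leq_eqVlt => /predU1P[rx|rx].
      by rewrite (box_inj rx).
    rewrite /f block_rank_le; have := columns x d xd.
    by rewrite x0 rx => /(_ isT) /andP[].
  have dAB : [disjoint A & B].
    rewrite -setI_eq0; apply/eqP/setP => x; rewrite in_setI in_set0.
    apply/negP => /andP[/HA[xc _] /HB[xd _]].
    by move: lcd; rewrite -xc -xd ltnn.
  have upper w : perm_on (A :|: B) w -> forall x, box_row x = 0%N -> w x = x.
    move=> wAB x x0; apply: (out_perm wAB); rewrite in_setU.
    by apply/negP => /orP[/HA|/HB]; rewrite x0 => -[].
  have cwA x : x \in A -> col_weight x = box_col c.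
    by move=> /HA[<- x0]; rewrite /col_weight gtn_eqF.
  have cwB x : x \in B -> col_weight x = box_col d.
    by move=> /HB[<- x0]; rewrite /col_weight gtn_eqF.
  (* Both columns being sorted, every rearrangement moves the larger blocks to
     the right, and the primary measure detects whether their contents change. *)
  have exch w : perm_on (A :|: B) w ->
      (col_measure T <= col_measure (rearr T w))%N /\
      (col_measure T = col_measure (rearr T w) ->
       forall z, (z \in B :\: w @: B) || (z \in w @: B :\: B) -> f z = f d).
    move=> wAB.
    have := weight_column_exchange f (ltnW lcd) cwA cwB dAB wAB.
    rewrite -(measure_rearr _ T w) -/(col_measure T) -/(col_measure (rearr T w)).
    have [|||le eqz] := @exchange_sum _ B (w @: B) f (f d).
    - by rewrite card_imset //; apply: perm_inj.
    - by move=> x; rewrite inE => /andP[_ /fB].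
    - move=> x; rewrite inE => /andP[xB /imsetP[y yB xy]].
      have : x \in A :|: B by rewrite xy (perm_closed _ wAB) in_setU yB orbT.
      by rewrite in_setU (negPf xB) orbF => /fA; apply: leq_trans.
    move=> E; split; first by move: E le; nia.
    move=> cE; apply: eqz; apply/eqP; rewrite -(eqn_pmul2l (_ : 0 < box_col d - box_col c)%N).
      by move/eqP: E; rewrite cE eqn_add2l eq_sym.
    by rewrite subn_gt0.
  pose same w := col_measure T == col_measure (rearr T w).
  (* If boxes are exchanged without changing the measure, then the blocks at c
     and d are equal, so the violation is an equality of odd blocks. *)
  have sameE w : perm_on (A :|: B) w -> same w ->
      (-1) ^+ (w : bool) *: e (v_ K (rearr T w)) = e (v_ K T).
    move=> wAB /eqP sw; have [_ /(_ sw) fz] := exch w wAB.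
    apply: (exchange_sign sum_a sum_b K dT HA HB dAB wAB (u := kt T d)) => z zP.
    have kz : kt T z = kt T d by apply/block_rank_inj/fz.
    split=> //.
    have cBw : #|B| = #|w @: B| by rewrite card_imset //; apply: perm_inj.
    have cc : #|B :\: w @: B| = #|w @: B :\: B|.
      by apply: (@addnI #|B :&: w @: B|); rewrite cardsID cBw setIC cardsID.
    have /card_gt0P[y yP] : (0 < #|w @: B :\: B|)%N.
      by case/orP: zP => zP; [rewrite -cc|]; apply/card_gt0P; exists z.
    have fy : f y = f d by apply: fz; rewrite yP orbT.
    have yA : y \in A.
      move: yP; rewrite in_setD => /andP[yB /imsetP[x xB yx]].
      have : y \in A :|: B by rewrite yx (perm_closed _ wAB) in_setU xB orbT.
      by rewrite in_setU (negPf yB) orbF.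
    have fcd : f c = f d by apply/eqP; rewrite eqn_leq fdc -fy fA.
    case/orP: viol => [|/andP[/eqP <- //]].
    by rewrite -block_rank_le -/(f c) -/(f d) fcd leqnn.
  have G : \sum_(w : {perm box la} | perm_on (A :|: B) w)
      (-1) ^+ (w : bool) *: e (v_ K (rearr T w)) = 0.
    transitivity (e (\sum_(w : {perm box la} | perm_on (A :|: B) w)
      (-1) ^+ (w : bool) *: v_ K (rearr T w))).
      by rewrite linear_sum; apply: eq_bigr => w _; rewrite linearZ.
    rewrite garnir ?linear0 // => p pC.
    have [x [y [xy rxy px py]]] := column_collision la_sorted rcd c0 lcd pC.
    by exists x, y; rewrite !in_setU px py orbT.
  move: G; rewrite (bigID same) /= => /eqP; rewrite addr_eq0 => /eqP G.
  have : \sum_(w : {perm box la} | perm_on (A :|: B) w && same w)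
      (-1) ^+ (w : bool) *: e (v_ K (rearr T w)) \in W.
    rewrite G memvN; apply: memv_suml => w /andP[wAB nsw]; apply: memvZ.
    apply: good; first by apply: is_set_tableau_upper => //; apply: upper.
    apply: measure_col_lt; rewrite ltn_neqAle nsw.
    by have [] := exch w wAB.
  rewrite (eq_bigr (fun _ => e (v_ K T))); last by move=> w /andP[]; apply: sameE.
  rewrite sumr_const -scaler_nat; set n := #|_| => nW; case/negP: badT.
  have n0 : n%:R != 0 :> K.
    have /pcharf0P -> := K0; rewrite -lt0n; apply/card_gt0P; exists 1%g.
    rewrite unfold_in /= /same rearr1 eqxx andbT; apply/subsetP => x.
    by rewrite inE perm1 eqxx.
  by rewrite -[e _]scale1r -(mulVf n0) -scalerA; apply: memvZ.
case/negP: badT; apply: HW => //; rewrite inE kappa_tableau_MT //.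
have /andP[/andP[/forallP S1 /forallP S2] _] := sT.
(* The columns of the full diagram: a box of the first row with a box above it
   is empty, hence smallest. *)
have le_col c d : box_col c = box_col d -> (box_row c <= box_row d)%N ->
    mle (kt T c) (kt T d) /\
    (c != d -> kt T c = kt T d -> odd (num_barred (kt T c))).
  move=> ccd; rewrite leq_eqVlt => /predU1P[rcd|rcd].
    by rewrite (box_inj rcd ccd) eqxx mle_refl.
  have [c0|c0] := posnP (box_row c); last first.
    have := columns c d ccd; rewrite c0 rcd => /(_ isT) /andP[-> /implyP H].
    by split=> // _ /eqP.
  have d0 : (0 < box_row d)%N by rewrite -c0.
  have /eqP kc : kt T c == empty_mblock k m r s.
    rewrite ffunE kappa_block_empty //; apply: (implyP (S2 c)).
    rewrite c0 eqxx ccd; apply: leq_trans (ltn_ord (tagged d)) _.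
    have := @sorted_leq_nth _ geq _ _ 0%N la la_sorted 1%N (box_row d).
    rewrite !inE; apply=> //; [move=> ? ? ? /= h h'; exact: leq_trans h | exact: leqnn | | exact: ltn_ord].
    by apply: leq_ltn_trans d0 (ltn_ord (tag d)).
  rewrite kc mle_empty; split=> // _ kd.
  have := implyP (S1 d) d0; rewrite -(kappa_block_empty sum_a sum_b).
  by move: kd; rewrite ffunE => <-; rewrite eqxx.
have le_row c d : box_row c = box_row d -> (box_col c <= box_col d)%N ->
    mle (kt T c) (kt T d) /\
    (c != d -> kt T c = kt T d -> ~~ odd (num_barred (kt T c))).
  move=> rcd; rewrite leq_eqVlt => /predU1P[ccd|ccd].
    by rewrite (box_inj rcd ccd) eqxx mle_refl.
  have [c0|c0] := posnP (box_row c).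
    have /andP[-> /implyP H] := row0 c d c0 (etrans (esym rcd) c0) ccd.
    by split=> // _ /eqP.
  have /andP[-> /implyP H] := rows c d rcd c0 ccd.
  by split=> // _ /eqP.
rewrite andTb; apply/and3P; split.
- apply/forallP => c; apply/forallP => d; apply/implyP => /andP[/eqP rcd ccd].
  by have [] := le_row c d rcd ccd.
- apply/forallP => c; apply/forallP => d; apply/implyP => /andP[/eqP rcd ccd].
  by have [] := le_col c d rcd ccd.
apply/forallP => c; apply/forallP => d; apply/implyP => /andP[cd /eqP kcd].
case: ifPn => [od|ev]; apply/eqP => E.
  case/orP: (leq_total (box_col c) (box_col d)) => h.
    by have [_ /(_ cd kcd)] := le_row c d E h; rewrite od.
  have [_] := le_row d c (esym E) h; rewrite eq_sym cd -kcd od.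
  by move=> /(_ isT erefl).
case/orP: (leq_total (box_row c) (box_row d)) => h.
  by have [_ /(_ cd kcd)] := le_col c d E h; apply/negP.
have [_] := le_col d c (esym E) h; rewrite eq_sym cd -kcd (negPf ev).
by move=> /(_ isT erefl).
Qed.

End Straightening.

(** * Standardization *)

Section Standardization.

Variables (k m r s : nat) (a : k.-tuple nat) (b : m.-tuple nat).
Hypotheses (sum_a : sumn a = r) (sum_b : sumn b = s).
Local Notation kap := (@kappa k m r s a b).
Local Notation q := (r + s).

Variables (la : seq nat) (T : mtableau k m r s la).
Hypothesis TM : T \in MT r s a b la.
Local Notation mempty := (empty_mblock k m r s).
Local Notation L := (sorted_content T).
Local Notation fib := (fibre r s a b).
Implicit Types (c d : box la).

Let offset j (x : 'I_(k + m)) := \sum_(S <- take j L) S x.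
Let segment j (x : 'I_(k + m)) :=
  take (nth mempty L j x) (drop (offset j x) (fib x)).

Lemma sorted_content_perm :
  perm_eq L [seq T c | c in [pred c | T c != mempty]].
Proof. by rewrite perm_sort. Qed.

Lemma count_content S : S != mempty -> count_mem S L = #|[set c | T c == S]|.
Proof.
move=> S0; have /seq.permP -> := sorted_content_perm; rewrite count_map.
rewrite -size_filter -filter_predI cardE /enum_mem size_filter.
rewrite size_filter; apply: eq_count => c /=; rewrite !inE.
by case: eqP => // ->; rewrite S0.
Qed.

Lemma mem_content S : S \in L -> S != mempty.
Proof.
by rewrite (perm_mem sorted_content_perm) => /imageP[c]; rewrite inE => ? ->.
Qed.

Lemma content_sum (x : 'I_(k + m)) : \sum_(S <- L) S x = size (fib x).
Proof.
rewrite size_fibre // (perm_big _ sorted_content_perm) big_image_cond /=.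
move: TM; rewrite inE => /and3P[_ /forallP/(_ x)/eqP <- _].
rewrite [RHS](bigID (fun c => T c != mempty)) /= [X in _ = _ + X]big1 ?addn0.
  by apply: eq_bigl => c; rewrite inE andbT.
by move=> c /negPn/eqP ->; rewrite ffunE.
Qed.

Lemma offset_next j j' (x : 'I_(k + m)) : j < j' -> j < size L ->
  offset j x + nth mempty L j x <= offset j' x.
Proof.
move=> jj' jL; rewrite /offset -(cat_take_drop j.+1 (take j' L)) big_cat /=.
rewrite take_takel // (take_nth mempty) // -cats1 big_cat big_seq1 /=.
exact: leq_addr.
Qed.

Lemma size_segment j (x : 'I_(k + m)) :
  j < size L -> size (segment j x) = nth mempty L j x.
Proof.
move=> jL; rewrite size_takel // size_drop -content_sum.
rewrite leq_subRL; last first.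
  by rewrite -(cat_take_drop j L) big_cat leq_addr.
by apply: leq_trans (offset_next x jL jL) _; rewrite /offset take_size.
Qed.

Lemma uniq_fibre x : uniq (fib x).
Proof. by rewrite filter_uniq // enum_uniq. Qed.

Lemma segment_kappa j (x : 'I_(k + m)) i : i \in segment j x -> kap i = x.
Proof. by move=> /mem_take/mem_drop; rewrite mem_filter => /andP[/eqP]. Qed.

Lemma segment_disjoint j j' (x : 'I_(k + m)) i : j < j' -> j < size L ->
  i \in segment j x -> i \notin segment j' x.
Proof.
move=> jj' jL; have o := offset_next x jj' jL.
rewrite /segment take_drop [X in take X]addnC => /mem_drop i1; apply/negP => /mem_take.
rewrite -(subnK o) -drop_drop => /mem_drop i2.
have := uniq_fibre x; rewrite -(cat_take_drop (offset j x + nth mempty L j x) (fib x)).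
rewrite cat_uniq => /and3P[_ /hasPn/(_ _ i2) /=].
by rewrite i1.
Qed.

Let block j : {set 'I_q} := \bigcup_(x : 'I_(k + m)) [set i in segment j x].

Lemma mem_block j i : (i \in block j) = (i \in segment j (letter sum_a sum_b i)).
Proof.
apply/bigcupP/idP => [[x _]|iS]; last by exists (letter sum_a sum_b i); rewrite ?inE.
rewrite inE => ix; have kx := segment_kappa ix.
by have -> : letter sum_a sum_b i = x by apply: val_inj.
Qed.

Lemma kappa_std_block j : j < size L -> kappa_block a b (block j) = nth mempty L j.
Proof.
move=> jL; apply/ffunP => x; apply: val_inj; rewrite /= kappa_blockE.
rewrite -(size_segment x jL) -(card_uniqP _); last first.
  by rewrite take_uniq // drop_uniq // uniq_fibre.
apply: eq_card => i; rewrite inE mem_block.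
apply/andP/idP => [[iS /eqP ix]|iS].
  by have <- : letter sum_a sum_b i = x by apply: val_inj.
have kx := segment_kappa iS; split; last by rewrite kx.
by have -> : letter sum_a sum_b i = x by apply: val_inj.
Qed.

Lemma block_disjoint j j' : j < j' -> j < size L -> [disjoint block j & block j'].
Proof.
move=> jj' jL; rewrite -setI_eq0; apply/eqP/setP => i; rewrite !inE !mem_block.
by apply/negP => /andP[/(segment_disjoint jj' jL)/negP].
Qed.

Lemma block_neq0 j : j < size L -> block j != set0.
Proof.
move=> jL; rewrite -(kappa_block_empty sum_a sum_b) kappa_std_block //.
by apply: mem_content; apply: mem_nth.
Qed.

Lemma std_blocks_disjoint B C : B \in std_blocks a b T -> C \in std_blocks a b T ->
  B != C -> [disjoint B & C].
Proof.
move=> /mapP[j + ->] /mapP[j' + ->]; rewrite !mem_iota !add0n /= => jL j'L.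
case: (ltngtP j j') => [jj'|jj'|->]; last by rewrite eqxx.
  by move=> _; apply: block_disjoint.
by move=> _; rewrite disjoint_sym; apply: block_disjoint.
Qed.

Lemma uniq_std_blocks : uniq (std_blocks a b T).
Proof.
apply/mkseq_uniqP => j j'; rewrite !inE => jL j'L; rewrite -!/(block _) => bjj'.
apply/eqP; apply: contraT; rewrite neq_ltn => /orP[] lt.
  have := block_disjoint lt jL; rewrite -bjj' -setI_eq0 setIid.
  by rewrite (negPf (block_neq0 jL)).
have := block_disjoint lt j'L; rewrite -bjj' -setI_eq0 setIid.
by rewrite (negPf (block_neq0 jL)).
Qed.

Lemma kappa_std_blocks : [seq kappa_block a b B | B <- std_blocks a b T] = L.
Proof.
rewrite -[RHS](mkseq_nth mempty) -map_comp; apply/eq_in_map => j.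
by rewrite mem_iota add0n => /= jL; rewrite -/(block j) kappa_std_block.
Qed.

Let std c := standardization a b T c.
Let choices c := sort (fun B C : {set 'I_q} => ll_le (set_word B) (set_word C))
  [seq B <- std_blocks a b T | kappa_block a b B == T c].
Let rank c := #|[set c' | (T c' == T c) && read_before c' c]|.

Lemma stdE c : std c = nth set0 (choices c) (rank c).
Proof. by rewrite /std ffunE. Qed.

Lemma read_before_irr c : read_before c c = false.
Proof. by rewrite /read_before !ltnn andbF. Qed.

Lemma read_before_trans c d f :
  read_before c d -> read_before d f -> read_before c f.
Proof. by rewrite /read_before => H1 H2; lia. Qed.

Lemma read_before_total c d : c != d -> read_before c d || read_before d c.
Proof.
move=> cd; rewrite /read_before; case: ltngtP => //= rcd.
by case: ltngtP => //= ccd; case/eqP: cd; apply: box_inj.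
Qed.

Lemma size_choices c : T c != mempty -> size (choices c) = #|[set d | T d == T c]|.
Proof.
move=> c0; rewrite size_sort size_filter -count_content // -kappa_std_blocks.
by rewrite [RHS]count_map.
Qed.

Lemma rank_lt c : T c != mempty -> rank c < size (choices c).
Proof.
move=> c0; rewrite size_choices //; apply/proper_card/properP; split.
  by apply/subsetP=> d; rewrite !inE => /andP[].
by exists c; rewrite !inE ?eqxx // read_before_irr.
Qed.

Lemma std_mem c : T c != mempty ->
  std c \in std_blocks a b T /\ kappa_block a b (std c) = T c.
Proof.
move=> /rank_lt/(mem_nth set0); rewrite -stdE mem_sort mem_filter.
by case/andP=> /eqP.
Qed.

Lemma std_empty c : T c = mempty -> std c = set0.
Proof.
move=> c0; rewrite stdE; suff -> : choices c = [::] by rewrite nth_nil.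
apply/nilP; rewrite /nilp size_sort size_filter eqn0Ngt -has_count.
apply/hasPn => B BL; rewrite c0; apply: mem_content.
by rewrite -kappa_std_blocks; apply: map_f.
Qed.

(** Equal blocks of the multiset tableau receive different standard blocks, as
    they have different ranks in the reading order. *)
Lemma std_inj c d : T c != mempty -> T d != mempty -> std c = std d -> c = d.
Proof.
move=> c0 d0 cd; apply/eqP; apply: contraT => ncd.
have [_ kc] := std_mem c0; have [_ kd] := std_mem d0.
have TT : T c = T d by rewrite -kc cd kd.
have ch : choices c = choices d by rewrite /choices TT.
have rlt x y : T x = T y -> read_before x y -> rank x < rank y.
  move=> Txy xy; apply/proper_card/properP; split.
    apply/subsetP=> z; rewrite !inE Txy => /andP[-> zx] /=.
    exact: read_before_trans xy.
  by exists x; rewrite !inE ?Txy ?eqxx ?xy // read_before_irr andbF.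
move: cd; rewrite !stdE ch => /eqP; rewrite nth_uniq.
- case/orP: (read_before_total ncd) => /rlt; rewrite TT => /(_ erefl).
    by case: ltngtP.
  by case: ltngtP.
- by rewrite -ch rank_lt.
- exact: rank_lt.
by rewrite sort_uniq filter_uniq // uniq_std_blocks.
Qed.

Lemma kappa_std : kappa_tableau a b (standardization a b T) = T.
Proof.
apply/ffunP => c; rewrite ffunE -/(std c).
have [c0|c0] := eqVneq (T c) mempty; last by have [] := std_mem c0.
by rewrite std_empty // c0; apply/eqP; rewrite (kappa_block_empty sum_a sum_b).
Qed.

Lemma std_disjoint : blocks_disjoint (standardization a b T).
Proof.
move=> c d cd; rewrite -/(std c) -/(std d).
have [c0|c0] := eqVneq (T c) mempty.
  by rewrite std_empty // -setI_eq0 set0I.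
have [d0|d0] := eqVneq (T d) mempty.
  by rewrite (std_empty d0) // -setI_eq0 setI0.
have [cB _] := std_mem c0; have [dB _] := std_mem d0.
by apply: std_blocks_disjoint => //; apply: contra_neq cd; apply: std_inj.
Qed.

(** The blocks are disjoint, so every letter occurs at most once; as the letters
    of each fibre of [kappa] occur as often as the fibre has elements, every letter
    occurs exactly once. *)
Lemma is_set_tableau_std : is_set_tableau (standardization a b T).
Proof.
have /and3P[TS /forallP Tsum _] : [&& tableau_shape mempty T,
    [forall x : 'I_(k + m), \sum_c (T c x : nat) == nth 0 (a ++ b) x] &
    [forall c, forall x, barred x ==> (T c x <= 1)]] by have := TM; rewrite inE.
rewrite /is_set_tableau -(kappa_tableau_shape sum_a sum_b) kappa_std TS.
apply/forallP => i0; pose x := letter sum_a sum_b i0.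
have le1 i : kap i == x -> \sum_c (i \in std c) <= 1 ?= iff (\sum_c (i \in std c) == 1).
  move=> _; apply/leqifP; case: eqP => // /eqP ne1; rewrite ltn_neqAle ne1 /=.
  have [/existsP[c ic]|/existsPn no] := boolP [exists c, i \in std c]; last first.
    by rewrite big1 // => c _; rewrite (negPf (no c)).
  rewrite (bigD1 c) //= ic big1 // => d dc.
  by rewrite (disjointFl (std_disjoint dc)).
have /leqifP := leqif_sum le1; case: ifP => [/forallP/(_ i0)/implyP|_].
  by rewrite eqxx => /(_ isT).
rewrite ltnNge => /negP[]; rewrite sum_nat_const muln1 exchange_big /=.
have -> : #|[pred i : 'I_q | kap i == x]| = size (fib x).
  rewrite -(card_uniqP (uniq_fibre x)); apply: eq_card => i.
  by rewrite mem_filter mem_enum andbT.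
rewrite size_fibre // -(eqP (Tsum x)); apply: leq_sum => c _.
rewrite -kappa_std ffunE kappa_blockE -sum1dep_card -big_mkcondl.
by [].
Qed.

End Standardization.

(** * Triangularity and the basis *)

Section Basis.

Variables (k m r s : nat) (a : k.-tuple nat) (b : m.-tuple nat).
Hypotheses (sum_a : sumn a = r) (sum_b : sumn b = s).
Local Notation q := (r + s).
Local Notation stable := (stable_perms r s a b).

Variables (la : seq nat) (K : fieldType).
Hypotheses (la_sorted : sorted geq la) (K0 : [pchar K]%R =i pred0).
Local Notation e := (e_ab r s a b la K).
Local Notation kt := (@kappa_tableau k m r s a b la).
Local Notation std := (@standardization k m r s a b la).
Implicit Types (X Y : set_tableau q la) (S T : mtableau k m r s la).
Implicit Types (c d : box la) (p w : {perm box la}).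

Lemma perm_tabloid_of g X :
  perm_tabloid g (tabloid_of X) = tabloid_of (perm_tableau g X).
Proof.
have g0 (B : {set 'I_q}) : (g @: B == set0) = (B == set0).
  by rewrite -!cards_eq0 card_imset //; apply: perm_inj.
apply/ffunP => i; rewrite !ffunE -imset_comp.
apply/setP => B; apply/imsetP/imsetP => -[c];
  rewrite !inE /= ?ffunE ?g0 => cP ->; by exists c; rewrite ?inE ?ffunE ?g0.
Qed.

(** A row of a tabloid records its nonempty blocks, which are pairwise distinct;
    the number of empty boxes of the row is then determined by its length. *)
Lemma tabloid_of_inj X Y : is_set_tableau X -> is_set_tableau Y ->
    tabloid_of X = tabloid_of Y ->
  exists2 w : {perm box la}, (forall c, box_row (w c) = box_row c) & rearr X w = Y.
Proof.
move=> sX sY XY.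
have injX (Z : set_tableau q la) c d : is_set_tableau Z -> Z c != set0 -> Z c = Z d -> c = d.
  move=> sZ c0 cd; apply/eqP; apply: contraNT c0 => ncd.
  by have := set_tableau_disjoint sZ ncd; rewrite -cd -setI_eq0 setIid.
have full (Z : set_tableau q la) (i : 'I_(size la)) : is_set_tableau Z ->
    #|[set c | (tag c == i) && (Z c != set0)]| = #|tabloid_of Z i|.
  move=> sZ; rewrite ffunE card_in_imset.
    by apply: eq_card => c; rewrite !inE.
  by move=> c d; rewrite inE => /andP[_ c0] _; apply: injX.
have nonempty (Z : set_tableau q la) (i : 'I_(size la)) B : is_set_tableau Z -> B != set0 ->
    #|[set c | (tag c, Z c) == (i, B)]| = (B \in tabloid_of Z i).
  move=> sZ B0; rewrite ffunE; case: imsetP => [[c]|no].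
    rewrite inE => /andP[ci c0] cB; apply/eqP/cards1P; exists c.
    apply/setP => d; rewrite !inE xpair_eqE; apply/andP/eqP => [[di /eqP dB]|->].
      by apply/esym/(injX Z) => //; rewrite dB cB.
    by rewrite -cB.
  apply: eq_card0 => c; rewrite !inE xpair_eqE; apply/negP => /andP[ci /eqP cB].
  by case: no; exists c; rewrite // inE ci cB.
have empties (Z : set_tableau q la) (i : 'I_(size la)) :
    #|[set c | (tag c, Z c) == (i, set0)]| +
    #|[set c | (tag c == i) && (Z c != set0)]| = #|[set c : box la | tag c == i]|.
  rewrite -[RHS](cardsID [set c | Z c == set0]); congr (_ + _).
    by apply: eq_card => c; rewrite !inE xpair_eqE.
  by apply: eq_card => c; rewrite !inE andbC.
have [w wP] : exists w : {perm box la},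
    forall c, (tag (w c), X (w c)) = (tag c, Y c).
  apply: (perm_of_card_fibres (f := fun c => (tag c, X c))) => -[i B].
  have [->|B0] := eqVneq B set0; last by rewrite !nonempty // XY.
  (* The empty boxes of a row are counted by complement. *)
  apply: (@addIn #|[set c | (tag c == i) && (X c != set0)]|).
  by rewrite empties full // XY -full // empties.
exists w; first by move=> c; rewrite /box_row; have [->] := wP c.
by apply/ffunP => c; rewrite ffunE; have [_ ->] := wP c.
Qed.

Lemma SSMT_std T : T \in SSMT r s a b la ->
  is_set_tableau (std T) /\ kt (std T) = T.
Proof.
by rewrite inE => /andP[TM _]; split; [apply: is_set_tableau_std|apply: kappa_std].
Qed.

Definition row_measure T := \sum_c box_row c * block_rank (T c).

Lemma semistandard_rows T c d : semistandard T -> box_row c = box_row d ->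
  box_col c <= box_col d -> block_rank (T c) <= block_rank (T d).
Proof.
case/and3P=> /forallP/(_ c)/forallP/(_ d)/implyP H _ _ rcd ccd.
by rewrite block_rank_le H // rcd eqxx.
Qed.

Lemma semistandard_cols T c d : semistandard T -> box_col c = box_col d ->
  box_row c <= box_row d -> block_rank (T c) <= block_rank (T d).
Proof.
case/and3P=> _ /forallP/(_ c)/forallP/(_ d)/implyP H _ rcd ccd.
by rewrite block_rank_le H // rcd eqxx.
Qed.

(** A row permutation preserves the measure and a column permutation of a
    tableau with sorted columns can only decrease it. In the equality case the two
    tableaux have the same rows, all of them sorted. *)
Lemma row_measure_rearr S T p w : semistandard S -> semistandard T ->
    (forall c, box_col (p c) = box_col c) ->
    (forall c, box_row (w c) = box_row c) ->
    rearr S p = rearr T w ->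
  row_measure T <= row_measure S /\
  (row_measure T = row_measure S -> rearr S p = S /\ S = T).
Proof.
move=> sS sT pcol wrow ST.
have TE : row_measure T = \sum_c box_row c * block_rank (S (p c)).
  rewrite /row_measure (reindex_inj (@perm_inj _ w)); apply: eq_bigr => c _ /=.
  by rewrite wrow; have /ffunP/(_ c) := ST; rewrite !ffunE => ->.
have [le eqr] := @max_rearrangement _ (@box_col la) (@box_row la)
  (fun c => block_rank (S c)) (fun c d cc rr => box_inj rr cc)
  (fun c d cc rr => semistandard_cols sS cc rr) p pcol.
rewrite TE; split=> // /eqr pS.
have {}pS : rearr S p = S.
  by apply/ffunP => c; rewrite ffunE; apply/block_rank_inj/pS.
split=> //; rewrite -{1}pS ST; apply/ffunP => c; rewrite ffunE.
apply: block_rank_inj; move: c.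
apply: (@monotone_rearrangement _ (@box_row la) (@box_col la)
  (fun c => block_rank (T c))) => // c d rcd ccd; first exact: semistandard_rows.
have wE x : T (w x) = S x.
  by have /ffunP/(_ x) := ST; rewrite pS ffunE.
by rewrite !wE; apply: semistandard_rows.
Qed.

Local Open Scope ring_scope.

Lemma e_tabloid (t t' : tabloid q la) :
  e (tabloid_vec K t) t' =
  (#|plain_young r s a b| * #|barred_young r s a b|)%:R^-1 *
  \sum_(u in stable) (-1) ^+ barred_sign u * (t' == perm_tabloid u t)%:R.
Proof.
rewrite (e_abE sum_a sum_b) ffunE; congr (_ * _); rewrite sum_ffunE.
by apply: eq_bigr => u _; rewrite perm_act_tabloid_vec !ffunE.
Qed.

(** [e] only relabels letters within the fibres of [kappa], so it does not change
    the multiset tableau, up to the order in the rows. *)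
Lemma e_tabloid_neq0 S T p : S \in SSMT r s a b la -> T \in SSMT r s a b la ->
    p \in col_group la ->
    e (tabloid_vec K (tabloid_of (rearr (std S) p))) (tabloid_of (std T)) != 0 ->
  exists2 w : {perm box la}, (forall c, box_row (w c) = box_row c) & rearr S p = rearr T w.
Proof.
move=> SS ST pC; have [sS kS] := SSMT_std SS; have [sT kT] := SSMT_std ST.
rewrite e_tabloid mulf_eq0 negb_or => /andP[_ nz].
have [u uS tE] : exists2 u, u \in stable &
    tabloid_of (std T) = perm_tabloid u (tabloid_of (rearr (std S) p)).
  have [/existsP[u /andP[uS /eqP tE]]|/existsPn no] := boolP [exists u,
     (u \in stable) && (tabloid_of (std T) == perm_tabloid u (tabloid_of (rearr (std S) p)))].
    by exists u.
  case/eqP: nz; apply: big1 => u uS; have := no u.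
  by rewrite uS /= => /negPf->; rewrite mulr0.
rewrite perm_tabloid_of in tE.
have sSp : is_set_tableau (rearr (std S) p).
  by apply: is_set_tableau_upper => //; have [] := col_groupP _ pC.
have [w wr wE] := tabloid_of_inj sT (is_set_tableau_perm u sSp) tE.
exists w => //; rewrite -kS -kT -!kappa_tableau_rearr wE kappa_tableau_perm //.
Qed.

Lemma y_sum S (t : tabloid q la) : y_ a b K S t =
  \sum_(p in col_group la) (-1) ^+ (p : bool) *
    e (tabloid_vec K (tabloid_of (rearr (std S) p))) t.
Proof.
rewrite /y_ /v_ linear_sum sum_ffunE; apply: eq_bigr => p _.
by rewrite linearZ ffunE.
Qed.

Lemma y_triangular S T : S \in SSMT r s a b la -> T \in SSMT r s a b la ->
    y_ a b K S (tabloid_of (std T)) != 0 ->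
  (row_measure T <= row_measure S)%N /\
  (row_measure T = row_measure S -> S = T).
Proof.
move=> SS ST; rewrite y_sum => nz.
have [p pC pnz] : exists2 p, p \in col_group la &
    e (tabloid_vec K (tabloid_of (rearr (std S) p))) (tabloid_of (std T)) != 0.
  have [/existsP[p /andP[pC pnz]]|/existsPn no] := boolP [exists p, (p \in col_group la) &&
     (e (tabloid_vec K (tabloid_of (rearr (std S) p))) (tabloid_of (std T)) != 0)].
    by exists p.
  case/eqP: nz; apply: big1 => p pC; have := no p.
  by rewrite pC /= negbK => /eqP->; rewrite mulr0.
have [w wr ST'] := e_tabloid_neq0 SS ST pC pnz.
have [pc _] := col_groupP _ pC.
have [|| le eqS] := row_measure_rearr _ _ pc wr ST'.
- by move: SS; rewrite inE => /andP[].
- by move: ST; rewrite inE => /andP[].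
by split=> // /eqS[].
Qed.

(** An element [u] of the Young subgroup that stabilizes the tabloid permutes
    equal blocks within the rows. Semistandardness makes these blocks even, so the
    same permutation of blocks is induced by some [g] of trivial sign. The quotient
    of [u] by [g] maps each block to itself, and since no barred letter is repeated
    in a block it fixes all the barred letters. *)
Lemma stabilizer_sign T u : T \in SSMT r s a b la -> u \in stable ->
  tabloid_of (perm_tableau u (std T)) = tabloid_of (std T) ->
  barred_sign u = false.
Proof.
move=> ST uS tE; have [sT kT] := SSMT_std ST.
have dT := set_tableau_disjoint sT.
have [w wr wE] := tabloid_of_inj sT (is_set_tableau_perm u sT) (esym tE).
have TMs : (T \in MT r s a b la) && semistandard T by move: ST; rewrite inE.
have {TMs}[TM /and3P[_ _ /forallP ss]] := andP TMs.
have wT : rearr T w = T by rewrite -{1}kT -kappa_tableau_rearr wE kappa_tableau_perm.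
have [||g [gS gE gs]] := @box_perm_sign _ _ _ _ a b sum_a sum_b la (std T) w false dT.
- by rewrite kT wT.
- move=> c wc; rewrite kT; apply/negbTE/negP => od.
  have /forallP/(_ (w c))/implyP := ss c; rewrite eq_sym wc /= od wr eqxx.
  by have /ffunP/(_ c) := wT; rewrite ffunE => -> /(_ (eqxx _)).
have hS : (u * g^-1)%g \in stable by rewrite groupM // groupV.
rewrite -(mulgKV g u) (barred_signM sum_a sum_b hS gS) gs addbF.
have hE : perm_tableau (u * g^-1)%g (std T) = std T.
  rewrite -perm_tableauM -wE gE perm_tableauM mulgV.
  by apply/ffunP => c; rewrite ffunE -[RHS]imset_id; apply: eq_imset => i; rewrite perm1.
set h := (u * g^-1)%g in hS hE *.
have /stableP hk : kappa_stable a b h by rewrite inE in hS.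
(* i and h i lie in the same block and have the same image. *)
have h1 i : i \in barred_letters r s -> h i = i.
  rewrite inE => ri; have [c ic] := set_tableau_box i sT.
  have hic : h i \in std T c by rewrite -hE ffunE imset_f.
  move: TM; rewrite inE => /and3P[_ _ /forallP/(_ c)/forallP].
  move/(_ (letter sum_a sum_b i)); rewrite /barred /= (kappa_barred sum_a sum_b) ri /=.
  rewrite -kT ffunE kappa_blockE => /card_le1_eqP; apply; rewrite !inE ?hic ?ic //=.
  by rewrite hk.
rewrite /barred_sign (_ : restr_perm _ _ = 1%g) ?odd_perm1 //.
have /andP[_ hN] := stable_plain_barred sum_a sum_b hS.
apply/permP => i; rewrite perm1; have [ib|ib] := boolP (i \in barred_letters r s).
  by rewrite restr_permE // h1.
by rewrite (out_perm (restr_perm_on _ _)).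
Qed.

(** A column permutation contributes only if it fixes the multiset tableau. Then
    it permutes equal odd blocks, so its own sign cancels against the sign coming
    from [e]. Likewise every element of the Young subgroup that contributes to the
    coefficient has sign one. The coefficient is a positive integer divided by the
    order of the Young subgroup. *)
Lemma y_diagonal T : T \in SSMT r s a b la ->
  y_ a b K T (tabloid_of (std T)) != 0.
Proof.
move=> ST; have [sT kT] := SSMT_std ST; have dT := set_tableau_disjoint sT.
have sst : semistandard T by move: ST; rewrite inE => /andP[].
pose t := tabloid_of (std T); have := K0 => /pcharf0P nat0.
rewrite y_sum (eq_bigr (fun p => (rearr T p == T)%:R * e (tabloid_vec K t) t)).
  rewrite -mulr_suml -natr_sum mulf_neq0 //.
    rewrite nat0 sum_nat_eq0 negb_forall; apply/existsP; exists 1%g.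
    by rewrite group1 rearr1 eqxx.
  rewrite e_tabloid mulf_neq0 //.
    rewrite invr_eq0 nat0 muln_eq0 negb_or -!lt0n; apply/andP; split;
    apply/card_gt0P; exists 1%g; rewrite inE;
    (apply/andP; split; [apply: perm_on1 | by apply/forallP => i; rewrite perm1]).
  rewrite (eq_bigr (fun u => (t == perm_tabloid u t)%:R)).
    rewrite -natr_sum nat0 sum_nat_eq0 negb_forall; apply/existsP; exists 1%g.
    rewrite group1 perm_tabloid_of (_ : perm_tableau 1%g _ = std T) ?eqxx //.
    by apply/ffunP => c; rewrite ffunE -[RHS]imset_id; apply: eq_imset => i; rewrite perm1.
  move=> u uS; case: eqP => [tE|_]; last by rewrite !mulr0.
  by rewrite (stabilizer_sign ST) ?mulr1 // -perm_tabloid_of.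
move=> p pC; have [pc _] := col_groupP _ pC.
have [pT|npT] := eqVneq (rearr T p) T; last first.
  rewrite mul0r; apply/eqP; rewrite mulf_eq0; apply/orP; right.
  apply/negPn/negP => /(e_tabloid_neq0 ST ST pC)[w wr /(row_measure_rearr sst sst pc wr)].
  by case=> _ /(_ erefl)[pT _]; rewrite pT eqxx in npT.
have [||g [gS gE gs]] := @box_perm_sign _ _ _ _ a b sum_a sum_b la (std T) p true dT.
- by rewrite kT pT.
- move=> c nc; rewrite kT; apply/negPn/negP => ev.
  case/and3P: sst => _ _ /forallP/(_ c)/forallP/(_ (p c))/implyP.
  rewrite eq_sym nc /= (negPf ev) pc eqxx.
  by have /ffunP/(_ c) := pT; rewrite ffunE => -> /(_ (eqxx _)).
rewrite gE -perm_tabloid_of -perm_act_tabloid_vec (e_stable sum_a sum_b) // gs /=.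
rewrite ffunE mul1r.
have signK (x : K) : (-1) ^+ (p : bool) * ((-1) ^+ (p : bool) * x) = x.
  by rewrite mulrA -signr_addb addbb mul1r.
exact: signK.
Qed.

Lemma y_free : free [seq y_ a b K T | T in SSMT r s a b la].
Proof.
apply/(@freeP _ _ _ [tuple of [seq y_ a b K T | T in SSMT r s a b la]]) => f f0 i.
apply/eqP/negPn/negP => fi.
(* Evaluate the relation at the tabloid of a tableau of maximal measure among
   those with a nonzero coefficient: only the diagonal term remains. *)
case: (@arg_maxnP _ i (fun j => f j != 0) (fun j => row_measure (enum_val j)) fi).
move=> {fi}j fj maxj; case/eqP: fj.
have /ffunP/(_ (tabloid_of (std (enum_val j)))) := f0.
rewrite sum_ffunE (bigD1 j) //= !ffunE nth_image big1 ?addr0 => [/eqP|l lj].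
  by rewrite mulf_eq0 (negPf (y_diagonal (enum_valP j))) orbF => /eqP.
rewrite ffunE nth_image; apply/eqP; rewrite mulf_eq0.
have [//|fl] := eqVneq (f l) 0; apply/negPn/negP => nz.
have [le eqlj] := y_triangular (enum_valP l) (enum_valP j) nz.
case/eqP: lj; apply: enum_val_inj; apply: eqlj; apply/eqP.
by rewrite eqn_leq le; apply: maxj.
Qed.

Lemma y_basis : basis_of (MPmod r s a b la K) [seq y_ a b K T | T in SSMT r s a b la].
Proof.
rewrite /basis_of y_free andbT /MPmod /Pmod limg_span eqEsubv; apply/andP; split.
  apply/span_subvP => _ /imageP[T ST ->]; have [sT _] := SSMT_std ST.
  by apply/memv_span/map_f/image_f.
apply/span_subvP => _ /mapP[_ /imageP[X sX ->] ->].
apply: (straighten sum_a sum_b) => // {sX}X sX kX.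
have [sS kS] := SSMT_std kX.
have [g gS ->] := relabel_tableau sum_a sum_b sX sS (esym kS).
rewrite (e_v_perm sum_a sum_b) //; apply/memvZ/memv_span.
exact: (image_f (y_ a b K)).
Qed.

End Basis.

Theorem theorem5p5 (R : realType) (k m r s n : nat)
    (a : k.-tuple nat) (b : m.-tuple nat) (la : seq nat) :
  sumn a = r -> sumn b = s -> 2 * r + 2 * s <= n ->
  is_partition la n -> n - nth 0 la 0 <= r + s ->
  basis_of (MPmod r s a b la R[i])
           [seq y_ a b R[i] T | T in SSMT r s a b la].
Proof.
move=> sum_a sum_b _ /and3P[la_sorted _ _] _.
by apply: y_basis => //; apply: Num.Theory.pchar_num.
Qed.
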